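(* Let $X$ be a separable Banach space and $T\in L(X)$. Consider the following assertions: (1) $B_T$ is chaotic on $c_0(X,\mathbb{Z})$; (2) $T$ satisfies the Kitai Criterion with $X_0=Y_0$; (3) $T$ satisfies the Kitai Criterion; (4) $T$ satisfies the Hypercyclicity Criterion along $(n)$ with $X_0=Y_0$; (5) $T$ satisfies the Hypercyclicity Criterion along $(n)$; (6) $T$ is mixing; (7) $B_T$ is mixing on $c_0(X,\mathbb{Z})$. Then $$(1)\Leftrightarrow(2)\Rightarrow(3)\Rightarrow(4)\Leftrightarrow(5)\Rightarrow(6)\Leftrightarrow(7),$$ and the other implications are false in general; that is, for any two assertions $(i)$, $(j)$ in the list such that $(i)\Rightarrow(j)$ does not follow from the displayed chain, there exist a separable Banach space $X$ and $T\in L(X)$ satisfying $(i)$ but not $(j)$.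
   Context: $L(X)$ denotes the bounded linear operators on $X$. $c_0(X,\mathbb{Z})$ is the Banach space of families $(x_k)_{k\in\mathbb{Z}}$ in $X$ with $\lim_{|k|\to\infty}\|x_k\|=0$ (sup norm), and $B_T$ is the bounded operator $B_T(x_k)_{k\in\mathbb{Z}}=(Tx_{k+1})_{k\in\mathbb{Z}}$. An operator $S$ on a Banach space $Y$ is mixing if for all non-empty open sets $U,V\subset Y$ the set $\{n\ge 0:S^nU\cap V\neq\emptyset\}$ is cofinite; it is chaotic if it is hypercyclic (some $y\in Y$ has dense orbit $\{S^ny:n\ge 0\}$) and its set of periodic points (those $y$ with $S^dy=y$ for some $d\ge1$) is dense in $Y$. $T$ satisfies the Kitai Criterion if there are dense subsets $X_0,Y_0$ of $X$ and a map $S:Y_0\to Y_0$ (not assumed linear or continuous) such that $T^nx\to 0$ for each $x\in X_0$, $S^ny\to 0$ for each $y\in Y_0$, and $TSy=y$ for each $y\in Y_0$. $T$ satisfies the Hypercyclicity Criterion along $(n)$ if there are dense subsets $X_0,Y_0$ of $X$ and maps $S_n:Y_0\to X$ $(n\ge1)$ such that $T^nx\to 0$ for each $x\in X_0$, $S_ny\to 0$ for each $y\in Y_0$, and $T^nS_ny\to y$ for each $y\in Y_0$. ''With $X_0=Y_0$'' means that the criterion is satisfied for some choice with $X_0=Y_0$. *)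

(* Defs.v *)
From HB Require Import structures.
From Stdlib Require Import Relation_Operators.
From mathcomp Require Import all_boot all_order all_algebra.
From mathcomp Require Import all_classical all_reals all_analysis.
From mathcomp Require Import complex zify.

Set Implicit Arguments.
Unset Strict Implicit.
Unset Printing Implicit Defensive.

Import Order.TTheory GRing.Theory Num.Theory.
Import numFieldNormedType.Exports.

Local Open Scope classical_set_scope.
Local Open Scope ring_scope.

Definition real_or_complex (R : realType) (K : numFieldType) : Prop :=
  K = (R : numFieldType) \/ K = (R[i] : numFieldType).

Definition separable (X : topologicalType) : Prop :=
  exists A : set X, countable A /\ dense A.

(* By [linear_boundedP], boundedness near 0 is the existence of M such that
   `|T x| <= M * `|x| for all x. *)
Record bounded_operator (K : numFieldType) (X : normedModType K) :=
  BoundedOperator {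
    bounded_operator_linear :> {linear X -> X} ;
    bounded_operatorP :
      bounded_near bounded_operator_linear (nbhs (0 : X)) }.

(* The filter of the limits as |k| goes to infinity, k ranging over int. *)
Definition absz_infty : set_system int :=
  filter_from [set: nat] (fun N => [set k : int | (N <= `|k|)%N]).

Global Instance absz_infty_filter : ProperFilter absz_infty.
Proof.
apply: filter_from_proper; last by move=> N _; exists N%:Z => /=.
apply: filter_from_filter; first by exists 0%N.
move=> M N _ _; exists (maxn M N) => // k /=.
by rewrite geq_max => /andP[].
Qed.

Section c0.
Context {K : numFieldType} {X : normedModType K}.

Definition c0_pred : {pred int -> X} :=
  [pred x : int -> X |
     `[< (fun k : int => `|x k|) @ absz_infty --> (0 : K) >]].

Lemma c0_predP (x : int -> X) : x \in c0_pred <-> x @ absz_infty --> (0 : X).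
Proof.
split=> [/asboolP /norm_cvg0P //|h]; apply/asboolP; exact/norm_cvg0P.
Qed.

Lemma c0_submod_closed : submod_closed c0_pred.
Proof.
split.
  by apply/c0_predP; exact: cvg_cst.
move=> a x y /c0_predP hx /c0_predP hy; apply/c0_predP.
have -> : (0 : X) = a *: 0 + 0 by rewrite scaler0 addr0.
by apply: cvgD => //; apply: cvgZr.
Qed.

HB.instance Definition _ :=
  GRing.isSubmodClosed.Build K (int -> X) c0_pred c0_submod_closed.

End c0.

Record c0 (K : numFieldType) (X : normedModType K) :=
  C0 { c0_fun :> int -> X ; c0_funP : c0_fun \in @c0_pred K X }.

Section c0_normed.
Context {K : numFieldType} {X : normedModType K}.

HB.instance Definition _ := [isSub for @c0_fun K X].
HB.instance Definition _ := [Choice of c0 X by <:].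
HB.instance Definition _ := [SubChoice_isSubLmodule of c0 X by <:].

Implicit Types x y : c0 X.

(* [supremum] is the least upper bound in the order of K; for K = R[i] the
   upper bounds of a non-empty set of real numbers are real. *)
Definition c0_norm x : K := supremum 0 (range (fun k : int => `|x k|)).

Lemma c0_cvg x : x k @[k --> absz_infty] --> (0 : X).
Proof. exact/c0_predP/c0_funP. Qed.

Lemma c0_max x : exists k, forall j, `|x j| <= `|x k|.
Proof.
have [[k0 xk0]|x0] := pselect (exists k, x k != 0); last first.
  exists 0 => j; suff -> : x j = 0 by rewrite normr0.
  by apply: contrapT => /eqP xj; apply: x0; exists j.
have /cvgr0Pnorm_lt /(_ `|x k0|) := @c0_cvg x.
rewrite normr_gt0 => /(_ xk0) [N _ hN].
pose s := k0 :: [seq n%:Z | n <- iota 0 N] ++ [seq - n%:Z | n <- iota 0 N].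
have [k ks kmax] : exists2 k, k \in s & {in s, forall j, `|x j| <= `|x k|}.
  have : s != [::] by [].
  elim: s => // a [|b s] IH _.
    by exists a; rewrite ?mem_head // => j; rewrite inE => /eqP ->.
  have [//|k ks kmax] := IH.
  have [h|h] := real_leP (normr_real (x a)) (normr_real (x k)).
    exists k; first by rewrite inE ks orbT.
    by move=> j; rewrite inE => /orP[/eqP ->//|/kmax].
  exists a; first by rewrite mem_head.
  move=> j; rewrite inE => /orP[/eqP ->//|/kmax jk].
  exact: le_trans jk (ltW h).
have k0s : k0 \in s by rewrite mem_head.
exists k => j; have [Nj|jN] := leqP N `|j|%N.
  by apply: le_trans (kmax _ k0s); apply/ltW/hN.
apply: kmax; rewrite inE mem_cat; apply/orP; right.
case: j jN => n /= jN; apply/orP; [left|right].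
  by apply/mapP; exists n; rewrite // mem_iota.
by apply/mapP; exists n.+1; rewrite ?NegzE // mem_iota.
Qed.

Lemma c0_norm_eq x k : (forall j, `|x j| <= `|x k|) -> c0_norm x = `|x k|.
Proof.
move=> kmax; rewrite /c0_norm /supremum.
have xkS : supremums (range (fun k : int => `|x k|)) `|x k|.
  split; first by move=> _ [j _ <-].
  by move=> u; apply; exists k.
case: ifPn => [/eqP E|_].
  by have : (set0 : set K) `|x k| by rewrite -E; exists k.
have [z _ Sz|/(_ _ xkS)//] := xgetP; exact: is_subset1_supremums Sz xkS.
Qed.

Lemma c0_norm_ge x k : `|x k| <= c0_norm x.
Proof. by have [m mx] := c0_max x; rewrite (c0_norm_eq mx). Qed.

Lemma c0_norm_le x (M : K) : (forall k, `|x k| <= M) -> c0_norm x <= M.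
Proof. by have [m mx] := c0_max x; rewrite (c0_norm_eq mx). Qed.

Lemma c0_ler_normD x y : c0_norm (x + y) <= c0_norm x + c0_norm y.
Proof.
apply: c0_norm_le => k; apply: le_trans (ler_normD _ _) _.
by apply: lerD; exact: c0_norm_ge.
Qed.

Lemma c0_normrZ (a : K) x : c0_norm (a *: x) = `|a| * c0_norm x.
Proof.
have [m mx] := c0_max x; rewrite (c0_norm_eq mx).
rewrite -normrZ; apply: (@c0_norm_eq (a *: x) m) => j.
change (`|a *: x j| <= `|a *: x m|).
by rewrite !normrZ ler_wpM2l.
Qed.

Lemma c0_normr0_eq0 x : c0_norm x = 0 -> x = 0.
Proof.
move=> x0; apply: val_inj; apply/funext => k /=.
by apply/eqP; rewrite -normr_le0 -x0; exact: c0_norm_ge.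
Qed.

HB.instance Definition _ :=
  Lmodule_isNormed.Build K (c0 X) c0_ler_normD c0_normrZ c0_normr0_eq0.

Lemma c0_normE x : `|x| = supremum 0 (range (fun k : int => `|x k|)).
Proof. by []. Qed.

End c0_normed.

Section c0_complete.
Context {K : numFieldType} {X : completeNormedModType K}.

Lemma c0_cauchy_cvg (F : set_system (c0 X)) :
  ProperFilter F -> cauchy F -> cvg F.
Proof.
move=> FF /cauchyP F_cauchy.
have dist_le (x y : c0 X) k : `|x k - y k| <= `|x - y|.
  exact: (c0_norm_ge (x - y) k).
pose G k : set_system X := (fun x : c0 X => x k) @ F.
have Gcvg k : cvg (G k).
  apply: cauchy_cvg; apply/cauchyP => e e0.
  have [x Fx] := F_cauchy e e0.
  exists (x k); apply: (@filterS _ F _ _ _ _ Fx) => y.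
  by rewrite -!ball_normE /= => /(le_lt_trans (dist_le x y k)).
pose l k : X := lim (G k).
have Fl e : 0 < e -> F [set x : c0 X | forall k, `|l k - x k| <= e].
  move=> e0; have e20 : 0 < e / 2 by rewrite divr_gt0.
  have [x Fx] := F_cauchy _ e20.
  apply: (filterS _ Fx) => y; rewrite -ball_normE /= => xy k.
  have xl : `|l k - x k| <= e / 2.
    rewrite distrC; apply/ler_addgt0Pr => d d0.
    have /cvgrPdist_le /(_ _ d0) Gd : G k --> l k := Gcvg k.
    have Fd : F [set z : c0 X | `|l k - z k| <= d] := Gd.
    have [z [xz lz]] := filter_ex (filterI Fx Fd).
    have -> : x k - l k = (x k - z k) + (z k - l k) by rewrite addrA subrK.
    rewrite (le_trans (ler_normD _ _)) // lerD //; last by rewrite distrC.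
    apply: le_trans (dist_le x z k) _.
    by move: xz; rewrite -ball_normE => /ltW.
  have -> : l k - y k = (l k - x k) + (x k - y k) by rewrite addrA subrK.
  rewrite (le_trans (ler_normD _ _)) // [e]splitr lerD //.
  exact: le_trans (dist_le x y k) (ltW xy).
have lc0 : l \in @c0_pred K X.
  apply/c0_predP/cvgr0Pnorm_lt => e e0.
  have e20 : 0 < e / 2 by rewrite divr_gt0.
  have [x xl] := filter_ex (Fl _ e20).
  have /cvgr0Pnorm_lt /(_ _ e20) := c0_cvg x.
  apply: filterS => k xk.
  have -> : l k = (l k - x k) + x k by rewrite subrK.
  by rewrite (le_lt_trans (ler_normD _ _)) // [e]splitr ler_ltD.
apply/cvg_ex; exists (C0 lc0).
apply/cvgrPdist_le => e /Fl; apply: filterS => x h.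
exact: (c0_norm_le (x := C0 lc0 - x)).
Qed.

HB.instance Definition _ := Uniform_isComplete.Build (c0 X) c0_cauchy_cvg.

End c0_complete.

Section backward_shift.
Context {K : numFieldType} {X : normedModType K}.
Variable T : bounded_operator X.

Lemma backward_shift_subproof (x : c0 X) :
  (fun k : int => T (x (k + 1))) \in @c0_pred K X.
Proof.
have T0 : T z @[z --> (0 : X)] --> (0 : X).
  have Tc : continuous T := bounded_linear_continuous (bounded_operatorP T).
  by have := Tc 0; rewrite /continuous_at linear0.
apply/c0_predP; apply: cvg_comp T0.
apply: (cvg_comp (fun k : int => k + 1) x _ (c0_cvg x)).
move=> A [N _ NA]; exists N.+1 => // k /= Nk; apply: NA => /=.
by case: k Nk => n /=; rewrite ?NegzE; lia.
Qed.

Definition backward_shift_fun (x : c0 X) : c0 X :=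
  C0 (backward_shift_subproof x).

Lemma backward_shift_linear : linear backward_shift_fun.
Proof.
move=> a x y; apply: val_inj; apply/funext => k /=.
exact: linearP.
Qed.

HB.instance Definition _ :=
  GRing.isLinear.Build K (c0 X) (c0 X) *:%R backward_shift_fun
    backward_shift_linear.

Lemma backward_shift_bounded :
  bounded_near backward_shift_fun (nbhs (0 : c0 X)).
Proof.
apply/(linear_boundedP backward_shift_fun).
have /linear_boundedP := bounded_operatorP T.
move=> h; near=> r => x.
have r0 : 0 <= r by near: r; apply: nbhs_pinfty_ge.
apply: c0_norm_le => k.
have Tr : forall z, `|T z| <= r * `|z| by near: r.
apply: le_trans (Tr _) _.
by rewrite ler_wpM2l //; exact: c0_norm_ge.
Unshelve. all: by end_near. Qed.

Definition backward_shift : bounded_operator (c0 X) :=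
  BoundedOperator backward_shift_bounded.

End backward_shift.

Section dynamics.
Context {Y : topologicalType}.
Implicit Type S : Y -> Y.

Definition mixing S : Prop :=
  forall U V : set Y, open U -> open V -> U !=set0 -> V !=set0 ->
    cofinite_set [set n | (iter n S @` U) `&` V !=set0].

Definition hypercyclic S : Prop :=
  exists y : Y, dense (range (fun n => iter n S y)).

Definition periodic_points S : set Y :=
  [set y | exists2 d, (1 <= d)%N & iter d S y = y].

Definition chaotic S : Prop := hypercyclic S /\ dense (periodic_points S).

End dynamics.

Section criteria.
Context {K : numFieldType} {X : normedModType K}.

(* The map on Y0 is the restriction of a total S that leaves Y0 invariant. *)
Definition Kitai_criterion_for (T : X -> X) (X0 Y0 : set X) : Prop :=
  [/\ dense X0, dense Y0 &
    exists S : X -> X, [/\ set_fun Y0 Y0 S,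
      forall x, X0 x -> iter n T x @[n --> \oo] --> (0 : X),
      forall y, Y0 y -> iter n S y @[n --> \oo] --> (0 : X) &
      forall y, Y0 y -> T (S y) = y]].

Definition hypercyclicity_criterion_for (T : X -> X) (X0 Y0 : set X) : Prop :=
  [/\ dense X0, dense Y0 &
    exists S : nat -> X -> X, [/\
      forall x, X0 x -> iter n T x @[n --> \oo] --> (0 : X),
      forall y, Y0 y -> S n y @[n --> \oo] --> (0 : X) &
      forall y, Y0 y -> iter n T (S n y) @[n --> \oo] --> y]].

End criteria.

Inductive assertion :=
  | Shift_chaotic | Kitai_same_set | Kitai | HC_same_set | HC
  | Mixing | Shift_mixing.

Definition satisfies (K : numFieldType) (X : normedModType K)
    (T : bounded_operator X) (a : assertion) : Prop :=
  match a with
  | Shift_chaotic => chaotic (backward_shift T)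
  | Kitai_same_set => exists X0 : set X, Kitai_criterion_for T X0 X0
  | Kitai => exists X0 Y0 : set X, Kitai_criterion_for T X0 Y0
  | HC_same_set => exists X0 : set X, hypercyclicity_criterion_for T X0 X0
  | HC => exists X0 Y0 : set X, hypercyclicity_criterion_for T X0 Y0
  | Mixing => mixing T
  | Shift_mixing => mixing (backward_shift T)
  end.

Inductive arrow : assertion -> assertion -> Prop :=
  | arrow12 : arrow Shift_chaotic Kitai_same_set
  | arrow21 : arrow Kitai_same_set Shift_chaotic
  | arrow23 : arrow Kitai_same_set Kitai
  | arrow34 : arrow Kitai HC_same_set
  | arrow45 : arrow HC_same_set HC
  | arrow54 : arrow HC HC_same_set
  | arrow56 : arrow HC Mixing
  | arrow67 : arrow Mixing Shift_mixing
  | arrow76 : arrow Shift_mixing Mixing.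

Definition follows : assertion -> assertion -> Prop :=
  clos_refl_trans assertion arrow.

(* Main.v *)
(* Everything positive rests on the closed additive reformulation of mixing: every
   x is approximated by x' with T^n x' small, and every y by T^n w with w small.
   A periodic point of B_T unrolls to a bilateral null orbit of T; a countable
   dense family of such orbits carries the section required by the Kitai criterion.

   The counterexamples are invertible operators on c0(c0 Y): the identity map along
   a chain of norms, one for each level k in Z, on the sequences z : int -> Y. The
   norms are weighted sup norms in which the coordinate z_0 is replaced by
   z_0 + kap k z, where the finite sum kap k z changes slowly with k. Opposite sums
   on the two sides give Kitai without X0 = Y0; sums over lacunary windows give a
   mixing operator whose null vectors all have z_0 = 0, and its inverse satisfies
   the hypercyclicity criterion but not the Kitai criterion. *)
From HB Require Import structures.
From Stdlib Require Import Relation_Operators.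
Require Import Defs.
From mathcomp Require Import all_boot all_order all_algebra.
From mathcomp Require Import all_classical all_reals all_analysis.
From mathcomp Require Import complex zify.

Set Implicit Arguments.
Unset Strict Implicit.
Unset Printing Implicit Defensive.

Import Order.TTheory GRing.Theory Num.Theory.
Import numFieldNormedType.Exports.

Local Open Scope classical_set_scope.
Local Open Scope ring_scope.

(** * Mixing of linear operators *)

(** If [T] has an inverse [S], a section of [T] must agree with [S] on [Y0]. The Kitai criterion
    then amounts to density of the vectors with [T^n x -> 0] and of those with [S^n x -> 0], and
    [X0 = Y0] makes the vectors with both properties dense. Each counterexample thus reduces to one
    nonzero bounded linear map, [z_0] read at level 0, that vanishes on the relevant null vectors.
    The obstacle is to keep the operators bounded and mixing at the same time. For mixing, [z_0]
    must be cancelled at a far level by a remote coordinate [z_i] that costs little at the starting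
    level. For boundedness, the sum added to [z_0] may gain or lose [z_i] only between levels where
    [z_i] has weight about 1. *)

Lemma pos_lower_bound (K : numFieldType) (a b : K) : 0 < a -> 0 < b ->
  exists2 c : K, 0 < c & c <= a /\ c <= b.
Proof.
move=> a0 b0; have /orP[ab|ba] := real_leVge (gtr0_real a0) (gtr0_real b0).
  by exists a.
by exists b.
Qed.

Section norm_density.
Context {K : numFieldType} {X : normedModType K}.
Implicit Types (A : set X) (x y : X) (e : K).

Lemma open_normP (U : set X) x : open U -> U x ->
  exists2 e : K, 0 < e & forall y, `|x - y| < e -> U y.
Proof.
move=> oU Ux; have : nbhs x U by exact: open_nbhs_nbhs.
move=> /nbhs_ballP[e /= e0 eU]; exists e => // y xy; apply: eU.
by rewrite -ball_normE.
Qed.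

Lemma open_norm_ball x e : open [set y | `|x - y| < e].
Proof.
have -> : [set y | `|x - y| < e] = ball x e by rewrite -ball_normE.
have [e0|e0] := boolP (0 < e); first exact: ball_open.
have -> : ball x e = set0; last exact: open0.
rewrite -ball_normE; apply/seteqP; split=> y //= xy.
by move: e0; rewrite (le_lt_trans _ xy).
Qed.

Lemma dense_normP A :
  dense A <-> forall x e, 0 < e -> exists2 y, A y & `|x - y| < e.
Proof.
split=> [dA x e e0|h U [x Ux] oU].
  have xe : [set y | `|x - y| < e] !=set0 by exists x; rewrite /= subrr normr0.
  by have [y []] := dA _ xe (open_norm_ball x e); exists y.
have [e e0 eU] := open_normP oU Ux; have [y Ay xy] := h x e e0.
by exists y; split=> //; exact: eU.
Qed.

Lemma cvg0_normP (u : nat -> X) : u n @[n --> \oo] --> (0 : X) <->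
  forall e, 0 < e -> \forall n \near \oo, `|u n| < e.
Proof. exact: cvgr0Pnorm_lt. Qed.

Lemma norm_lt2D e x y : `|x| < e / 2 -> `|y| < e / 2 -> `|x + y| < e.
Proof.
by move=> hx hy; rewrite (le_lt_trans (ler_normD _ _)) // [e]splitr ltrD.
Qed.

Lemma dist_lt2D e x y z : `|x - y| < e / 2 -> `|y - z| < e / 2 -> `|x - z| < e.
Proof. by move=> h1 h2; rewrite -(subrK y x) -addrA norm_lt2D. Qed.

End norm_density.

Lemma cofinite_nearP (A : set nat) :
  cofinite_set A <-> \forall n \near \oo, A n.
Proof.
split=> [/finite_fsetP[F hF]|[N _ hN]].
  exists (\max_(i <- finmap.enum_fset F) i).+1 => // n /= Fn.
  apply: contrapT => nA; have : (~` A) n by [].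
  rewrite hF /= => nF; have := @leq_bigmax_seq _ (finmap.enum_fset F) xpredT id n nF erefl.
  by rewrite leqNgt Fn.
apply: (@sub_finite_set _ _ `I_N); last exact: finite_II.
by move=> n /= nA; rewrite ltnNge; apply/negP => /hN.
Qed.

Section linear_iterates.
Context {K : numFieldType} {X : normedModType K}.
Variable T : bounded_operator X.

Lemma bounded_operator_continuous : continuous T.
Proof. exact: bounded_linear_continuous (bounded_operatorP T). Qed.

Lemma iter_linear n : linear (iter n T).
Proof. by elim: n => [//|n IH] a x y /=; rewrite IH linearP. Qed.

Lemma iter_linearD n x y : iter n T (x + y) = iter n T x + iter n T y.
Proof. by have := iter_linear n 1 x y; rewrite !scale1r. Qed.

Lemma iter_linear0 n : iter n T 0 = 0.
Proof. by elim: n => //= n ->; rewrite linear0. Qed.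

Lemma iter_continuous n : continuous (iter n T).
Proof.
elim: n => [|n IH] x; first exact: cvg_id.
apply: (@continuous_comp _ _ _ (iter n T) T x (IH x)).
exact: bounded_operator_continuous.
Qed.

(* Both conditions are additive in the point and closed, which reduces their
   verification to a set of vectors spanning a dense subspace. *)
Definition nearly_null (x : X) : Prop := forall e : K, 0 < e ->
  \forall n \near \oo, exists2 x', `|x - x'| < e & `|iter n T x'| < e.

Definition nearly_reached (y : X) : Prop := forall e : K, 0 < e ->
  \forall n \near \oo, exists2 w, `|w| < e & `|y - iter n T w| < e.

(** By linearity [x' + w] lies near [x] and [iter n T (x' + w)] near [y]. Conversely, one of the two
    open sets is taken to be a ball about 0. *)
Lemma mixingP :
  mixing T <-> (forall x, nearly_null x) /\ (forall y, nearly_reached y).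
Proof.
split=> [mT|[hs hu] U V oU oV [x Ux] [y Vy]].
  have ball_ex (x : X) e : 0 < e -> [set y | `|x - y| < e] !=set0.
    by move=> e0; exists x; rewrite /= subrr normr0.
  have near_ball (x y : X) e : 0 < e ->
      \forall n \near \oo, exists2 x', `|x - x'| < e & `|y - iter n T x'| < e.
    move=> e0; have /cofinite_nearP := mT _ _ (open_norm_ball x e)
      (open_norm_ball y e) (ball_ex x e e0) (ball_ex y e e0).
    by apply: filterS => n [_ [[x' xx' <-] /=]]; exists x'.
  split=> x e e0.
    by apply: filterS (near_ball x 0 e e0) => n [x' xx']; rewrite sub0r normrN; exists x'.
  by apply: filterS (near_ball 0 x e e0) => n [x']; rewrite sub0r normrN; exists x'.
have [d d0 dU] := open_normP oU Ux; have [e e0 eV] := open_normP oV Vy.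
have d20 : 0 < d / 2 by rewrite divr_gt0.
have e20 : 0 < e / 2 by rewrite divr_gt0.
have [c c0 [cd ce]] := pos_lower_bound d20 e20.
apply/cofinite_nearP; apply: filterS2 (hs x c c0) (hu y c c0) => n.
move=> [x' xx' Tx'] [w w0 Tw]; exists (iter n T (x' + w)); split.
  exists (x' + w) => //; apply: dU; apply: (@dist_lt2D _ _ _ _ x').
    exact: lt_le_trans cd.
  by rewrite opprD addrA subrr sub0r normrN; exact: lt_le_trans cd.
apply: eV; rewrite iter_linearD opprD addrA addrAC norm_lt2D ?normrN //.
  exact: lt_le_trans ce.
exact: lt_le_trans ce.
Qed.

Lemma nearly_nullD x y : nearly_null x -> nearly_null y -> nearly_null (x + y).
Proof.
move=> hx hy e e0; have e20 : 0 < e / 2 by rewrite divr_gt0.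
apply: filterS2 (hx _ e20) (hy _ e20) => n [x' xx' Tx'] [y' yy' Ty'].
exists (x' + y'); last by rewrite iter_linearD norm_lt2D.
by rewrite opprD addrACA norm_lt2D.
Qed.

Lemma nearly_reachedD x y :
  nearly_reached x -> nearly_reached y -> nearly_reached (x + y).
Proof.
move=> hx hy e e0; have e20 : 0 < e / 2 by rewrite divr_gt0.
apply: filterS2 (hx _ e20) (hy _ e20) => n [x' xx' Tx'] [y' yy' Ty'].
exists (x' + y'); first by rewrite norm_lt2D.
by rewrite iter_linearD opprD addrACA norm_lt2D.
Qed.

Lemma nearly_null_closed x :
  (forall e : K, 0 < e -> exists2 y, nearly_null y & `|x - y| < e) -> nearly_null x.
Proof.
move=> hx e e0; have e20 : 0 < e / 2 by rewrite divr_gt0.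
have [y hy xy] := hx _ e20; apply: filterS (hy _ e20) => n [y' yy' Ty'].
exists y'; first exact: dist_lt2D xy yy'.
by rewrite (lt_trans Ty') // ltr_pdivrMr // ltr_pMr // ltr1n.
Qed.

Lemma nearly_reached_closed x :
  (forall e : K, 0 < e -> exists2 y, nearly_reached y & `|x - y| < e) ->
  nearly_reached x.
Proof.
move=> hx e e0; have e20 : 0 < e / 2 by rewrite divr_gt0.
have [y hy xy] := hx _ e20; apply: filterS (hy _ e20) => n [w w0 Tw].
exists w; last exact: dist_lt2D xy Tw.
by rewrite (lt_trans w0) // ltr_pdivrMr // ltr_pMr // ltr1n.
Qed.

Lemma null_nearly_null x : iter n T x @[n --> \oo] --> (0 : X) -> nearly_null x.
Proof.
move=> /cvg0_normP h e e0; apply: filterS (h e e0) => n Tx.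
by exists x; rewrite // subrr normr0.
Qed.

End linear_iterates.

(** * Finitely supported families in [c0] and separability *)

Section c0_finite.
Context {K : numFieldType} {X : normedModType K}.
Implicit Types (x y : c0 X) (k : int) (N : nat).

Lemma c0D x y k : (x + y) k = x k + y k. Proof. by []. Qed.
Lemma c0N x k : (- x) k = - x k. Proof. by []. Qed.
Lemma c0B x y k : (x - y) k = x k - y k. Proof. by []. Qed.
Lemma c0P x y : (forall k, x k = y k) -> x = y.
Proof. by move=> h; apply: val_inj; apply/funext. Qed.

Lemma c0_norm_lt x (M : K) : (forall k, `|x k| < M) -> `|x| < M.
Proof.
have [k mx] := c0_max x; move=> h; apply: le_lt_trans (h k).
exact: c0_norm_le.
Qed.

Lemma c0_tail x (e : K) : 0 < e ->
  exists N, forall k, (N <= `|k|)%N -> `|x k| < e.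
Proof.
move=> e0; have /cvgr0Pnorm_lt /(_ _ e0) [N _ hN] := c0_cvg x.
by exists N => k; exact: hN.
Qed.

Lemma c0_pred_tail (f : int -> X) :
  (forall e : K, 0 < e -> exists N, forall k, (N <= `|k|)%N -> `|f k| < e) ->
  f \in @c0_pred K X.
Proof.
move=> h; apply/c0_predP/cvgr0Pnorm_lt => e /h[N hN].
by exists N.
Qed.

Lemma c0_pred_finite (f : int -> X) N :
  (forall k, (N <= `|k|)%N -> f k = 0) -> f \in @c0_pred K X.
Proof.
by move=> h; apply: c0_pred_tail => e e0; exists N => k /h ->; rewrite normr0.
Qed.

Lemma c0_single_subproof k (x : X) :
  (fun j => if j == k then x else 0) \in @c0_pred K X.
Proof.
apply: (@c0_pred_finite _ `|k|.+1) => j kj.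
by case: eqVneq kj => // ->; rewrite ltnn.
Qed.

Definition c0_single k (x : X) : c0 X := C0 (c0_single_subproof k x).

Lemma c0_singleE k (u : X) j : c0_single k u j = if j == k then u else 0.
Proof. by []. Qed.

Lemma c0_single_eq k (u : X) : c0_single k u k = u.
Proof. by rewrite c0_singleE eqxx. Qed.

Lemma c0_singleD k (u v : X) : c0_single k (u + v) = c0_single k u + c0_single k v.
Proof.
by apply: c0P => j; rewrite c0D !c0_singleE; case: ifP; rewrite ?addr0.
Qed.

Lemma c0_singleN k (u : X) : c0_single k (- u) = - c0_single k u.
Proof.
by apply: c0P => j; rewrite c0N !c0_singleE; case: ifP; rewrite ?oppr0.
Qed.

Lemma c0_singleB k (u v : X) : c0_single k (u - v) = c0_single k u - c0_single k v.
Proof. by rewrite c0_singleD c0_singleN. Qed.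

Lemma c0_single_norm k (u : X) : `|c0_single k u| = `|u|.
Proof.
apply/eqP; rewrite eq_le; apply/andP; split.
  by apply: c0_norm_le => j; rewrite c0_singleE; case: ifP; rewrite ?normr0.
by rewrite -{1}(c0_single_eq k u); exact: c0_norm_ge.
Qed.

Definition int_window N : seq int := [seq n%:Z - N%:Z | n <- iota 0 N.*2.+1].

Lemma mem_int_window N k : (k \in int_window N) = (`|k| <= N)%N.
Proof.
apply/mapP/idP => [[n] | kN].
  by rewrite mem_iota => nN ->; lia.
by exists (absz (k + N%:Z)); rewrite ?mem_iota; lia.
Qed.

Lemma int_window_uniq N : uniq (int_window N).
Proof. by rewrite map_inj_uniq ?iota_uniq // => a b; lia. Qed.

Lemma c0_sumE (I : Type) (s : seq I) (f : I -> c0 X) k :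
  (\sum_(i <- s) f i) k = \sum_(i <- s) f i k.
Proof. by elim/big_rec2: _ => // i u v _ <-. Qed.

Lemma c0_approx x (e : K) : 0 < e ->
  exists N, `|x - \sum_(k <- int_window N) c0_single k (x k)| < e.
Proof.
move=> e0; have [N hN] := c0_tail x e0; exists N; apply: c0_norm_lt => j.
rewrite c0B c0_sumE; have [jN|Nj] := leqP `|j|%N N.
  rewrite (bigD1_seq j) ?mem_int_window ?int_window_uniq //= eqxx.
  rewrite big1 ?addr0 ?subrr ?normr0 // => i /negPf ij.
  by rewrite eq_sym ij.
rewrite big_seq big1 ?subr0; first exact/hN/ltnW.
move=> i; rewrite mem_int_window c0_singleE; case: eqVneq => // <-.
by rewrite leqNgt Nj.
Qed.

Lemma c0_ind (P : c0 X -> Prop) :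
  (forall x y, P x -> P y -> P (x + y)) ->
  (forall x, (forall e : K, 0 < e -> exists2 y, P y & `|x - y| < e) -> P x) ->
  (forall k u, P (c0_single k u)) -> forall x, P x.
Proof.
move=> PD Pc P1 x; apply: Pc => e /(c0_approx x)[N hN].
eexists; last exact: hN.
elim: (int_window N) => [|k s IH]; last by rewrite big_cons; exact: PD.
(* The empty sum is itself a family with a single entry, so [P 0] is not a separate premise. *)
rewrite big_nil; suff -> : 0 = c0_single 0 0 by [].
by apply: c0P => j; rewrite c0_singleE; case: ifP.
Qed.

End c0_finite.

Lemma nested_c0_ind (K : numFieldType) (X : normedModType K)
    (P : c0 (c0 X) -> Prop) :
  (forall x y, P x -> P y -> P (x + y)) ->
  (forall x, (forall e : K, 0 < e -> exists2 y, P y & `|x - y| < e) -> P x) ->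
  (forall k i u, P (c0_single k (c0_single i u))) -> forall x, P x.
Proof.
move=> PD Pc P1; apply: c0_ind => // k.
apply: (@c0_ind _ _ (fun u => P (c0_single k u))) => // [x y Px Py|].
  by rewrite c0_singleD; exact: PD.
move=> x h; apply: Pc => e /h[y Py xy]; exists (c0_single k y) => //.
by rewrite -c0_singleB c0_single_norm.
Qed.

Lemma countable_enum (T : choiceType) (x0 : T) (A : set T) : countable A ->
  exists a : nat -> T, A `<=` range a.
Proof.
move=> /countable_injP[f finj].
exists (fun n => xget x0 [set x | A x /\ f x = n]) => x Ax; exists (f x) => //.
have [y _ [Ay fy]|/(_ x)] := xgetP; last by case.
by apply: finj; rewrite ?inE.
Qed.

Lemma c0_separable (K : numFieldType) (X : normedModType K) :
  separable X -> separable (c0 X).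
Proof.
move=> [A [cA dA]]; have [a Aa] := countable_enum 0 cA.
pose v (s : seq (int * nat)) := \sum_(p <- s) c0_single p.1 (a p.2) : c0 X.
exists (range v); split.
  exact: card_le_trans (card_image_le v _) (countableP [set: seq (int * nat)]).
apply/dense_normP; apply: c0_ind => [x y hx hy e e0|x hx e e0|k u e e0].
- have e20 : 0 < e / 2 by rewrite divr_gt0.
  have [_ [s _ <-] xs] := hx _ e20; have [_ [t _ <-] yt] := hy _ e20.
  exists (v (s ++ t)); first by exists (s ++ t).
  by rewrite /v big_cat /= opprD addrACA norm_lt2D.
- have e20 : 0 < e / 2 by rewrite divr_gt0.
  have [y hy xy] := hx _ e20; have [z zv yz] := hy _ e20.
  by exists z => //; exact: dist_lt2D xy yz.
- have [b /Aa[n _ <-] ub] := (dense_normP _).1 dA u e e0.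
  exists (v [:: (k, n)]); first by exists [:: (k, n)].
  by rewrite /v big_seq1 -c0_singleB c0_single_norm.
Qed.

(** * Mixing of the shift *)

Section shift_iterates.
Context {K : numFieldType} {X : normedModType K}.
Variable T : bounded_operator X.

Lemma iter_shiftE n (x : c0 X) k :
  iter n (backward_shift T) x k = iter n T (x (k + n%:Z)).
Proof.
elim: n k => [|n IH] k; first by rewrite addr0.
have -> : iter n.+1 (backward_shift T) x k =
  T (iter n (backward_shift T) x (k + 1)) by [].
rewrite IH -iterS; congr (iter _ T (x _)); lia.
Qed.

End shift_iterates.

(** The form in which the Archimedean property of the real and complex scalars enters. *)
Definition inv_nat_null (K : numFieldType) : Prop :=
  forall e : K, 0 < e -> exists n : nat, n.+1%:R^-1 < e.

Section shift_mixing.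
Context {K : numFieldType} {X : normedModType K}.
Variable T : bounded_operator X.

Lemma iter_shift_single n k (u : X) :
  iter n (backward_shift T) (c0_single k u) = c0_single (k - n%:Z) (iter n T u).
Proof.
apply: c0P => j; rewrite iter_shiftE !c0_singleE eq_sym -subr_eq eq_sym.
by case: ifP => // _; rewrite iter_linear0.
Qed.

(** The [n]-th iterate of the shift carries coordinate [k + n] to coordinate [k] through [T^n].
    Reading coordinates [0], [-n] and [n] passes from the shift to [T]; families with one entry give
    the way back. *)
Lemma shift_mixingP : mixing (backward_shift T) <-> mixing T.
Proof.
split=> /mixingP[hs hu]; apply/mixingP; split.
- move=> u e e0; apply: filterS (hs (c0_single 0 u) e e0) => n [x ux Bx].
  exists (x 0).
    by apply: le_lt_trans ux; have := c0_norm_ge (c0_single 0 u - x) 0; rewrite c0B c0_single_eq.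
  apply: le_lt_trans Bx; have := c0_norm_ge (iter n (backward_shift T) x) (- n%:Z).
  by rewrite iter_shiftE addNr.
- move=> u e e0; apply: filterS (hu (c0_single 0 u) e e0) => n [w w0 Bw].
  exists (w n%:Z); first exact: le_lt_trans (c0_norm_ge w _) w0.
  apply: le_lt_trans Bw.
  have := c0_norm_ge (c0_single 0 u - iter n (backward_shift T) w) 0.
  by rewrite c0B c0_single_eq iter_shiftE add0r.
- apply: c0_ind => [||k u e e0]; [exact: nearly_nullD|exact: nearly_null_closed|].
  apply: filterS (hs u e e0) => n [v uv Tv]; exists (c0_single k v).
    by rewrite -c0_singleB c0_single_norm.
  by rewrite iter_shift_single c0_single_norm.
- apply: c0_ind => [||k u e e0]; [exact: nearly_reachedD|exact: nearly_reached_closed|].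
  apply: filterS (hu u e e0) => n [v uv Tv]; exists (c0_single (k + n%:Z) v).
    by rewrite c0_single_norm.
  by rewrite iter_shift_single addrK -c0_singleB c0_single_norm.
Qed.

End shift_mixing.

(** * From the Kitai criterion to mixing *)

Section criteria_chain.
Context {K : numFieldType} {X : normedModType K}.
Variable T : bounded_operator X.

Lemma Kitai_section_iter (Y0 : set X) (S : X -> X) n y : set_fun Y0 Y0 S ->
  (forall y, Y0 y -> T (S y) = y) -> Y0 y ->
  Y0 (iter n S y) /\ iter n T (iter n S y) = y.
Proof.
move=> SY TS Yy; elim: n => [//|n [IH1 IH2]]; split; first exact: SY.
by rewrite iterSr iterS TS.
Qed.

Lemma Kitai_HC : satisfies T Kitai -> satisfies T HC.
Proof.
move=> [X0 [Y0 [dX dY [S [SY T0 S0 TS]]]]]; exists X0, Y0; split=> //.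
exists (fun n => iter n S); split=> // y Yy.
apply: cvg_near_cst; apply: nearW => n.
by have [_ ->] := Kitai_section_iter n SY TS Yy.
Qed.

Lemma HC_mixing : satisfies T HC -> satisfies T Mixing.
Proof.
move=> [X0 [Y0 [/dense_normP dX /dense_normP dY [S [T0 S0 TS]]]]].
apply/mixingP; split=> x.
  apply: nearly_null_closed => e e0; have [y Xy xy] := dX x e e0.
  by exists y => //; apply: null_nearly_null; exact: T0.
apply: nearly_reached_closed => e e0; have [y Yy xy] := dY x e e0.
exists y => // d d0; have /cvg0_normP/(_ _ d0) := S0 _ Yy.
have /cvgrPdist_lt/(_ _ d0) := TS _ Yy.
by apply: filterS2 => n h1 h2; exists (S n y).
Qed.

Lemma nearly_reached_sequence (hK : inv_nat_null K) y : nearly_reached T y ->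
  exists u : nat -> X, u n @[n --> \oo] --> (0 : X) /\
    iter n T (u n) @[n --> \oo] --> y.
Proof.
move=> hy; pose P n m w : Prop :=
  `|w| < m.+1%:R^-1 :> K /\ `|y - iter n T w| < m.+1%:R^-1 :> K.
(* The tolerances are nested, so a vector meeting the finest attainable one meets all coarser ones.
   With [M = n], a single sequence then serves every tolerance eventually. *)
have best n M : exists w, forall m, (m <= M)%N -> (exists w', P n m w') -> P n m w.
  elim: M => [|M [w hw]].
    have [[w' h]|h] := pselect (exists w', P n 0%N w').
      by exists w' => m; rewrite leqn0 => /eqP ->.
    by exists 0 => m; rewrite leqn0 => /eqP ->.
  have [[w' [h1 h2]]|h] := pselect (exists w', P n M.+1 w'); last first.
    exists w => m; rewrite leq_eqVlt => /orP[/eqP ->//|]; exact: hw.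
  exists w' => m mM _.
  have le : M.+2%:R^-1 <= m.+1%:R^-1 :> K by rewrite lef_pV2 ?posrE ?ltr0n ?ler_nat.
  by split; [exact: lt_le_trans le|exact: lt_le_trans le].
have [u hu] := choice (fun n => best n n).
have uP m : \forall n \near \oo, P n m (u n).
  have m0 : 0 < m.+1%:R^-1 :> K by rewrite invr_gt0 ltr0n.
  apply: filterS2 (hy _ m0) (nbhs_infty_ge m) => n [w w1 w2] mn.
  by apply: hu => //; exists w.
exists u; split; [apply/cvg0_normP|apply/cvgrPdist_lt] => e /hK[m me].
  by apply: filterS (uP m) => n [h _]; exact: lt_trans me.
by apply: filterS (uP m) => n [_ h]; exact: lt_trans me.
Qed.

(** Mixing provides maps [S_n] on all of [X], so [Y0] can be chosen freely, in particular equal to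
    [X0]. *)
Lemma mixing_HC_same_set (hK : inv_nat_null K) (X0 : set X) : mixing T ->
  dense X0 -> (forall x, X0 x -> iter n T x @[n --> \oo] --> (0 : X)) ->
  satisfies T HC_same_set.
Proof.
move=> /mixingP[_ hu] dX T0; exists X0; split=> //.
have [S hS] := choice (fun y => nearly_reached_sequence hK (hu y)).
by exists (fun n y => S y n); split=> // y _; have [] := hS y.
Qed.

Lemma HC_HC_same_set (hK : inv_nat_null K) :
  satisfies T HC -> satisfies T HC_same_set.
Proof.
move=> h; have [X0 [Y0 [dX _ [S [T0 _ _]]]]] := h.
exact: mixing_HC_same_set (HC_mixing h) dX T0.
Qed.

End criteria_chain.

(** * Hypercyclicity of mixing operators *)

Section mixing_hypercyclic.
Context {K : numFieldType} {X : completeNormedModType K}.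
Variable T : bounded_operator X.
Hypothesis hK : inv_nat_null K.

Lemma nested_balls_cvg (x : nat -> X) (r : nat -> K) :
  (forall n, 0 < r n) -> (forall n, r n.+1 <= n.+1%:R^-1) ->
  (forall n z, `|x n.+1 - z| <= r n.+1 -> `|x n - z| <= r n) ->
  exists y, forall n, `|x n - y| <= r n.
Proof.
move=> r0 rn nested.
have nestedD n m z : `|x (m + n)%N - z| <= r (m + n)%N -> `|x n - z| <= r n.
  by elim: m => [//|m IH] /nested.
have near_n n m : (n <= m)%N -> `|x n - x m| <= r n.
  by move=> /subnK <-; apply: (nestedD n (m - n)%N); rewrite subrr normr0 ltW.
have : cauchy (x @ \oo).
  apply/cauchyP => e e0; have [n ne] := hK e0; exists (x n.+1).
  exists n.+1 => // m /= nm; rewrite -ball_normE /=.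
  by apply: le_lt_trans (near_n _ _ nm) _; exact: le_lt_trans (rn n) ne.
move=> /cauchy_cvg; move/cvg_ex => [y /cvgrPdist_lt xy]; exists y => n.
apply/ler_addgt0Pr => e /xy h; near \oo => m.
have nm : (n <= m)%N by near: m; exact: nbhs_infty_ge.
have ym : `|y - x m| < e by near: m.
rewrite -(subrK (x m) (x n)) -addrA (le_trans (ler_normD _ _)) // lerD ?near_n //.
by rewrite distrC ltW.
Unshelve. all: by end_near. Qed.

(** Baire's argument with explicit nested closed balls: on the [n]-th ball some power of [T] maps
    every point close to a prescribed vector of a countable dense set. *)
Lemma mixing_hypercyclic : separable X -> mixing T -> hypercyclic T.
Proof.
move=> [A [cA dA]] mT; have [a Aa] := countable_enum 0 cA.
(* Task [n] encodes the index of a dense vector and a tolerance; a number that encodes no pair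
   repeats the task [(0, 0)]. *)
pose target n : nat * nat := odflt (0%N, 0%N) (unpickle n).
pose hit n z := exists m, `|a (target n).1 - iter m T z| < (target n).2.+1%:R^-1 :> K.
have step (p : nat * (X * K)) : exists q : X * K, 0 < p.2.2 ->
    [/\ 0 < q.2, q.2 <= p.1.+1%:R^-1 & forall z, `|q.1 - z| <= q.2 ->
      `|p.2.1 - z| <= p.2.2 /\ hit p.1 z].
  case: p => n [x r] /=; have [r0|/negP r0] := boolP (0 < r); last by exists (x, r).
  have r20 : 0 < r / 2 by rewrite divr_gt0.
  have i0 m : 0 < m.+1%:R^-1 :> K by rewrite invr_gt0 ltr0n.
  have Un : [set y | `|x - y| < r / 2] !=set0 by exists x; rewrite /= subrr normr0.
  have Vn : [set y | `|a (target n).1 - y| < (target n).2.+1%:R^-1] !=set0.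
    by exists (a (target n).1); rewrite /= subrr normr0.
  have /cofinite_nearP/filter_ex[m [_ [[x' /= xx' <-] /= Tx']]] :=
    mT _ _ (open_norm_ball _ _) (open_norm_ball _ _) Un Vn.
  have [d d0 dT] := open_normP (open_comp (fun z _ => @iter_continuous _ _ T m z)
    (open_norm_ball (a (target n).1) (target n).2.+1%:R^-1)) Tx'.
  have [c c0 [cr cn]] := pos_lower_bound r20 (i0 n).
  have d20 : 0 < d / 2 by rewrite divr_gt0.
  have [b b0 [bc bd]] := pos_lower_bound c0 d20.
  (* [b <= r / 2] keeps the new ball inside the old one, and [b <= d / 2 < d] puts the closed ball
     inside the open preimage of the target. *)
  exists (x', b) => _; split=> //=; first exact: le_trans bc cn.
  move=> z zb; split.
    rewrite -(subrK x' x) -addrA (le_trans (ler_normD _ _)) // [r]splitr lerD //.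
      exact: ltW.
    exact: le_trans zb (le_trans bc cr).
  exists m; apply: dT; rewrite (le_lt_trans zb) // (le_lt_trans bd) //.
  by rewrite ltr_pdivrMr // ltr_pMr // ltr1n.
have [f hf] := choice step.
pose fix q n : X * K := if n is m.+1 then f (m, q m) else (0, 1).
have q0 n : 0 < (q n).2.
  by elim: n => [|n IH]; rewrite ?ltr01 //; have [] := hf (n, q n) IH.
have hq n z : `|(q n.+1).1 - z| <= (q n.+1).2 -> `|(q n).1 - z| <= (q n).2 /\ hit n z.
  by have [_ _] := hf (n, q n) (q0 n); exact.
have [] := @nested_balls_cvg (fun n => (q n).1) (fun n => (q n).2) q0.
- by move=> n; have [] := hf (n, q n) (q0 n).
- by move=> n z /hq[].
move=> y hy; exists y; apply/dense_normP => x e e0.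
have e20 : 0 < e / 2 by rewrite divr_gt0.
have [b /Aa[n _ <-] xa] := (dense_normP _).1 dA x _ e20.
have [k ke] := hK e20.
have [_ [m]] := hq (pickle (n, k)) y (hy _).
rewrite /target pickleK /= => am.
exists (iter m T y); first by exists m.
by apply: dist_lt2D xa _; exact: lt_trans ke.
Qed.

End mixing_hypercyclic.

(** * Bilateral null orbits and chaos of the shift *)

Section null_orbits.
Context {K : numFieldType} {X : normedModType K}.
Variable T : bounded_operator X.

(* A fixed point of the shift is a bilateral orbit of T that tends to 0 in both
   directions. *)
Definition null_orbit (o : c0 X) : Prop := forall k, T (o (k + 1)) = o k.

Lemma null_orbit_iter o n k : null_orbit o -> iter n T (o (k + n%:Z)) = o k.
Proof.
move=> oT; elim: n k => [|n IH] k; first by rewrite addr0.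
by rewrite iterSr (_ : k + n.+1%:Z = (k + n%:Z) + 1) ?oT ?IH //; lia.
Qed.

Lemma null_orbit_cvg0 o k : null_orbit o ->
  iter n T (o k) @[n --> \oo] --> (0 : X).
Proof.
move=> oT; apply/cvg0_normP => e /(c0_tail o)[N hN].
exists (N + `|k|)%N => // n /= Nn.
by rewrite -(subrK n%:Z k) null_orbit_iter // hN //; lia.
Qed.

(** Since [o] tends to 0, a nonzero value occurs only at finitely many positions. *)
Lemma c0_last_position (o : c0 X) k : o k != 0 ->
  exists2 l, o l = o k & forall j, o j = o k -> (j <= l)%R.
Proof.
move=> ok; have /(c0_tail o)[N hN] : 0 < `|o k| by rewrite normr_gt0.
have lt_N j : o j = o k -> (`|j| < N)%N.
  by move=> jk; rewrite ltnNge; apply/negP => /hN; rewrite jk ltxx.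
pose P m := `[< o (m%:Z - N%:Z) = o k >].
have exP : exists m, P m.
  exists (absz (k + N%:Z)); apply/asboolP; congr (o _); have := lt_N k erefl; lia.
have bP m : P m -> (m <= N.*2)%N by move=> /asboolP/lt_N; lia.
have [m /asboolP mP mmax] := ex_maxnP exP bP.
exists (m%:Z - N%:Z) => // j jk; have := lt_N j jk => jN.
have /mmax : P (absz (j + N%:Z)).
  by apply/asboolP; rewrite -jk; congr (o _); lia.
lia.
Qed.

(* Each point of the union of the orbits is followed along the orbit of least
   index through it, from its last visit there: the index is then eventually
   constant along the iterates of the section, and the position increases. *)
Lemma null_orbits_section (o : nat -> c0 X) : (forall n, null_orbit (o n)) ->
  exists S : X -> X, let D := [set x | exists n k, x = o n k] in
    [/\ set_fun D D S, forall y, D y -> iter n S y @[n --> \oo] --> (0 : X) &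
      forall y, D y -> T (S y) = y].
Proof.
move=> oT; pose D := [set x : X | exists n k, x = o n k].
have pick y : exists p : nat * int, D y -> y != 0 ->
    [/\ o p.1 p.2 = y, forall n k, o n k = y -> (p.1 <= n)%N &
        forall k, o p.1 k = y -> (k <= p.2)%R].
  have [[n0 [k0 y0]]|nD] := pselect (D y); last by exists (0%N, 0).
  have [->|yn0] := eqVneq y 0; first by exists (0%N, 0).
  have exP : exists n, `[< exists k, o n k = y >].
    by exists n0; apply/asboolP; exists k0.
  have [n /asboolP[k nk] nmin] := ex_minnP exP.
  have [|l lk lmax] := @c0_last_position (o n) k; first by rewrite nk.
  exists (n, l) => _ _; split=> /=; first by rewrite lk.
    by move=> m j mj; apply: nmin; apply/asboolP; exists j.
  by move=> j jy; apply: lmax; rewrite nk.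
have [f hf] := choice pick.
(* A last visit to 0 need not exist, so [S] fixes 0, where [T 0 = 0]. *)
pose S y := if y == 0 then 0 else o (f y).1 ((f y).2 + 1).
have DS : set_fun D D S.
  move=> y Dy; rewrite /S; case: eqP => [<- //|_].
  by exists (f y).1, ((f y).2 + 1).
have DSn n y : D y -> D (iter n S y) by move=> Dy; elim: n => //= n; exact: DS.
have S0 n : iter n S 0 = 0 by elim: n => //= n ->; rewrite /S eqxx.
exists S; split=> //; last first.
  move=> y Dy; rewrite /S; case: eqVneq => [->|y0]; first by rewrite linear0.
  by rewrite oT; have [] := hf y Dy y0.
have main N y : D y -> ((f y).1 <= N)%N -> iter n S y @[n --> \oo] --> (0 : X).
  elim/ltn_ind: N y => N IH y Dy yN.
  (* Three cases: the iterates reach 0 and stay there, the index drops and induction applies, or the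
     index never changes and the positions go to infinity along one orbit. *)
  have [[m [m0|mN]]|const] := pselect (exists m, iter m S y = 0 \/
      ((f (iter m S y)).1 < (f y).1)%N).
  - apply: cvg_near_cst; exists m => // n /= /subnK <-.
    by rewrite iterD m0 S0.
  - have := IH _ (leq_trans mN yN) _ (DSn m y Dy) (leqnn _).
    have -> : (fun n => iter n S (iter m S y)) = (fun n => iter (n + m)%N S y).
      by apply/funext => n; rewrite iterD.
    by rewrite (cvg_shiftn m (fun n => iter n S y)).
  have nz m : iter m S y != 0 by apply/eqP => m0; apply: const; exists m; left.
  have fm m : (f (iter m S y)).1 = (f y).1 /\ (m%:Z + (f y).2 <= (f (iter m S y)).2)%R.
    elim: m => [|m [IH1 IH2]]; first by rewrite add0r.
    have [h1 h2 h3] := hf _ (DSn m.+1 y Dy) (nz m.+1).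
    have Sm : o (f y).1 ((f (iter m S y)).2 + 1) = iter m.+1 S y.
      by rewrite iterS /S (negPf (nz m)) IH1.
    have e1 : (f (iter m.+1 S y)).1 = (f y).1.
      apply/eqP; rewrite eqn_leq (h2 _ _ Sm) leqNgt.
      by apply/negP => lt; apply: const; exists m.+1; right.
    split=> //; have := h3 ((f (iter m S y)).2 + 1).
    rewrite e1 => /(_ Sm); lia.
  apply/cvg0_normP => e /(c0_tail (o (f y).1))[M hM].
  exists (M + `|(f y).2|)%N => // n /= Mn.
  have [<- _ _] := hf _ (DSn n y Dy) (nz n).
  have [-> pos] := fm n; apply: hM; lia.
by move=> y Dy; exact: main Dy (leqnn _).
Qed.

Lemma iter_fixM (Y : Type) (f : Y -> Y) d m y :
  iter d f y = y -> iter (m * d) f y = y.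
Proof. by move=> dy; elim: m => // m IH; rewrite mulSn iterD IH. Qed.

(** The orbit is formally [o k = (B^(-k) z) k], with the exponent reduced modulo the period [d] to
    make sense. It tends to 0 because only [d] families are involved. *)
Lemma periodic_null_orbit (z : c0 X) : periodic_points (backward_shift T) z ->
  exists2 o, null_orbit o & o 0 = z 0.
Proof.
move=> [d d1 dz]; pose r k := absz ((- k) %% d%:Z)%Z.
have rd k : (r k < d)%N by rewrite /r; have := ltz_pmod (- k) (d := d%:Z); lia.
pose f k := iter (r k) (backward_shift T) z k.
have f0 : f \in @c0_pred K X.
  apply: c0_pred_tail => e e0.
  have : exists N, forall m, (m < d)%N -> forall k, (N <= `|k|)%N ->
      `|iter m (backward_shift T) z k| < e.
    elim: (d) => [|n [N hN]]; first by exists 0%N.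
    have [M hM] := c0_tail (iter n (backward_shift T) z) e0.
    exists (maxn N M) => m; rewrite ltnS leq_eqVlt => mn k.
    rewrite geq_max => /andP[Nk Mk].
    by move: mn => /orP[/eqP ->|mn]; [exact: hM|exact: hN].
  by move=> [N hN]; exists N => k; exact: hN.
exists (C0 f0); last by rewrite /= /f /r oppr0 mod0z.
move=> k; rewrite /= /f.
have -> : T (iter (r (k + 1)) (backward_shift T) z (k + 1)) =
  iter (r (k + 1)).+1 (backward_shift T) z k by [].
(* From [k + 1] to [k] the exponent grows by one or wraps from [d] to 0, where periodicity is
   used. *)
have [->//|[-> ->]] : (r (k + 1)).+1 = r k \/ ((r (k + 1)).+1 = d /\ r k = 0%N).
  have E := divz_eq (- k) d; have Rd := rd k; rewrite /r in Rd *.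
  have R0 : 0 <= ((- k) %% d%:Z)%Z by rewrite modz_ge0 //; lia.
  move: E R0 Rd; set b := (_ %% _)%Z; set q := (_ %/ _)%Z => E b0 bd.
  have [b1|b1] := leqP 1 `|b|%N; [left|right].
    have -> : - (k + 1) = q * d%:Z + (b - 1) by lia.
    by rewrite modzMDl modz_small; lia.
  have -> : - (k + 1) = (q - 1) * d%:Z + (d%:Z - 1) by lia.
  by rewrite modzMDl modz_small; lia.
by rewrite dz.
Qed.

End null_orbits.

Section chaotic_shift.
Context {K : numFieldType} {X : completeNormedModType K}.
Variable T : bounded_operator X.
Hypotheses (hK : inv_nat_null K) (sX : separable X).

(** By separability, countably many null orbits have a dense union, and countability is what allows
    [null_orbits_section] to select an orbit of least index. *)
Lemma chaotic_shift_Kitai_same_set :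
  satisfies T Shift_chaotic -> satisfies T Kitai_same_set.
Proof.
move=> [_ /dense_normP dP]; have [A [cA dA]] := sX.
have [a Aa] := countable_enum 0 cA.
pose target n : nat * nat := odflt (0%N, 0%N) (unpickle n).
have pick n : exists o : c0 X, null_orbit T o /\
    `|a (target n).1 - o 0| < (target n).2.+1%:R^-1 :> K.
  have i0 : 0 < (target n).2.+1%:R^-1 :> K by rewrite invr_gt0 ltr0n.
  have [z zP az] := dP (c0_single 0 (a (target n).1)) _ i0.
  have [w oT oz] := periodic_null_orbit zP.
  exists w; split=> //; rewrite oz; apply: le_lt_trans az.
  by have := c0_norm_ge (c0_single 0 (a (target n).1) - z) 0; rewrite c0B c0_single_eq.
have [/= o ho] := choice pick.
have oT n := (ho n).1.
have [S [SD S0 TS]] := null_orbits_section oT.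
pose D := [set x : X | exists n k, x = o n k].
have dD : dense D.
  apply/dense_normP => x e e0; have e20 : 0 < e / 2 by rewrite divr_gt0.
  have [_ /Aa[n _ <-] xa] := (dense_normP _).1 dA x _ e20.
  have [k ke] := hK e20.
  exists (o (pickle (n, k)) 0); first by exists (pickle (n, k)), 0.
  apply: dist_lt2D xa _; apply: lt_trans ke.
  by have [_] := ho (pickle (n, k)); rewrite /target pickleK.
exists D; split=> //; exists S; split=> // _ [n [k ->]].
exact: null_orbit_cvg0.
Qed.

(** Membership in the common set makes the forward iterates [T^n y] and the backward iterates
    [S^n y] both tend to 0. *)
Lemma Kitai_null_orbit X0 y : Kitai_criterion_for T X0 X0 -> X0 y ->
  exists2 w, null_orbit T w & w 0 = y.
Proof.
move=> [_ _ [S [SX T0 S0 TS]]] Xy.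
pose f (k : int) := match k with Posz n => iter n S y | Negz n => iter n.+1 T y end.
have f0 : f \in @c0_pred K X.
  apply: c0_pred_tail => e e0.
  have /cvg0_normP/(_ _ e0)[N _ hN] := S0 _ Xy.
  have /cvg0_normP/(_ _ e0)[M _ hM] := T0 _ Xy.
  exists (maxn N M) => -[n|n]; rewrite geq_max => /andP[Nn Mn]; first exact: hN.
  exact: hM.
exists (C0 f0) => // k; rewrite /=; case: k => [n|[|n]] //.
  have -> : Posz n + 1 = Posz n.+1 by lia.
  by rewrite /= TS //; elim: n => //= n; exact: SX.
by have -> : Negz n.+1 + 1 = Negz n by lia.
Qed.

Lemma Kitai_periodic_dense X0 : Kitai_criterion_for T X0 X0 ->
  dense (periodic_points (backward_shift T)).
Proof.
move=> hX0; apply/dense_normP; apply: c0_ind => [x y hx hy e e0|x hx e e0|k u e e0].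
- have e20 : 0 < e / 2 by rewrite divr_gt0.
  have [v [d d1 dv] xv] := hx _ e20; have [w [d' d'1 dw] yw] := hy _ e20.
  exists (v + w); last by rewrite opprD addrACA norm_lt2D.
  exists (d * d')%N; first by rewrite muln_gt0 d1.
  by rewrite iter_linearD (iter_fixM _ dw) mulnC (iter_fixM _ dv).
- have e20 : 0 < e / 2 by rewrite divr_gt0.
  have [y hy xy] := hx _ e20; have [z zv yz] := hy _ e20.
  by exists z => //; exact: dist_lt2D xy yz.
have e20 : 0 < e / 2 by rewrite divr_gt0.
have [/dense_normP dX _ _] := hX0; have [y Xy uy] := dX u _ e20.
have [w wT w0] := Kitai_null_orbit hX0 Xy.
have [N hN] := c0_tail w e20.
(* Keeping one entry out of [N + 1] of the null orbit centred at [k] makes the family periodic with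
   period [N + 1]. The kept entries other than [w 0] lie in the small tail of [w]. *)
pose f j := if (N.+1%:Z %| j - k)%Z then w (j - k) else 0.
have f0 : f \in @c0_pred K X.
  apply: c0_pred_tail => d /(c0_tail w)[M hM]; exists (M + `|k|)%N => j Mj.
  rewrite /f; case: ifP => [_|]; last by rewrite normr0 => _; exact: le_lt_trans (hM M _).
  apply: hM; lia.
exists (C0 f0).
  exists N.+1 => //; apply: c0P => j; rewrite iter_shiftE /= /f.
  have -> : j + N.+1%:Z - k = (j - k) + N.+1%:Z by lia.
  rewrite rpredDr ?dvdzz //; case: ifP => _; last exact: (iter_linear0 T N.+1).
  exact: (null_orbit_iter N.+1 _ wT).
apply: (@dist_lt2D _ _ _ _ (c0_single k y)).
  by rewrite -c0_singleB c0_single_norm.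
apply: c0_norm_lt => j; rewrite c0B c0_singleE /= /f.
have [->|jk] := eqVneq j k; first by rewrite subrr dvdz0 w0 subrr normr0.
rewrite sub0r normrN; case: ifP => [|_]; last by rewrite normr0.
move=> /dvdzP[q jq]; have q0 : (0 < `|q|)%N.
  rewrite absz_gt0; apply: contra jk => /eqP q0.
  by rewrite -subr_eq0 jq q0 mul0r.
by apply: hN; rewrite jq abszM (leq_trans (leqnSn N)) // leq_pmull.
Qed.

Lemma Kitai_same_set_chaotic_shift :
  satisfies T Kitai_same_set -> satisfies T Shift_chaotic.
Proof.
move=> [X0 hX0]; split; last exact: Kitai_periodic_dense hX0.
apply: (mixing_hypercyclic hK (c0_separable sX)).
by apply/shift_mixingP/HC_mixing/Kitai_HC; exists X0, X0.
Qed.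

End chaotic_shift.

(** * Completeness of the complex line and nonzero separable Banach spaces *)

Section complex_complete.
Variable R : realType.
Implicit Type z : R[i].

Lemma normc_ge_Im z : (`|complex.Im z|%:C <= `|z|)%C.
Proof.
rewrite normc_def lecR -sqrtr_sqr ler_wsqrtr //.
by rewrite lerDr sqr_ge0.
Qed.

Lemma normc_le_ReIm z : `|z| <= (`|complex.Re z| + `|complex.Im z|)%:C%C.
Proof.
rewrite normc_def lecR -[leRHS]ger0_norm ?addr_ge0 // -sqrtr_sqr ler_wsqrtr //.
rewrite sqrrD !real_normK ?num_real // lerD2r lerDl.
by rewrite mulrn_wge0 // mulr_ge0.
Qed.

Lemma complex_pos (e : R[i]) : 0 < e -> exists2 d : R, 0 < d & e = d%:C%C.
Proof.
by case: e => a b; rewrite ltcE /= => /andP[/eqP -> a0]; exists a.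
Qed.

Lemma complex_cauchy_cvg (F : set_system R[i]^o) :
  ProperFilter F -> cauchy F -> cvg F.
Proof.
move=> FF /cauchyP Fc.
have part (p : R[i] -> R) : (forall z w, p (z - w) = p z - p w) ->
    (forall z, (`|p z|%:C <= `|z|)%C) -> cvg (p @ F).
  move=> pB p_le; apply: (@R_complete R (p @ F)); apply/cauchyP => e e0.
  have e0' : 0 < (e%:C)%C by rewrite ltcR.
  have [z Fz] := Fc _ e0'; exists (p z).
  apply: (@filterS _ F _ _ _ _ Fz) => w; rewrite -!ball_normE /= -pB => zw; rewrite -ltcR.
  exact: le_lt_trans (p_le _) zw.
have ReB z w : complex.Re (z - w) = complex.Re z - complex.Re w by case: z w => ? ? [].
have ImB z w : complex.Im (z - w) = complex.Im z - complex.Im w by case: z w => ? ? [].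
have /cvg_ex[a /cvgrPdist_lt aP] := part _ ReB (@normc_ge_Re R).
have /cvg_ex[b /cvgrPdist_lt bP] := part _ ImB normc_ge_Im.
apply/cvg_ex; exists (a +i* b)%C; apply/cvgrPdist_lt => _ /complex_pos[e e0 ->].
have e20 : 0 < e / 2 by rewrite divr_gt0.
have := aP _ e20; have := bP _ e20; apply: filterS2 => z bz az.
apply: le_lt_trans (normc_le_ReIm _) _; rewrite ltcR ReB ImB /=.
by rewrite [e]splitr ltrD.
Qed.

End complex_complete.

(* An alias, since the completeness instance on [regular] is that of the reals. *)
Definition complex_line (R : realType) : Type := R[i]^o.

HB.instance Definition _ (R : realType) :=
  NormedModule.copy (complex_line R) R[i]^o.
HB.instance Definition _ (R : realType) :=
  Uniform_isComplete.Build (complex_line R) (@complex_cauchy_cvg R).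

Section scalars.
Variables (R : realType) (K : numFieldType).
Hypothesis hK : real_or_complex R K.

Lemma real_inv_nat (e : R) : 0 < e -> exists n, n.+1%:R^-1 < e.
Proof.
move=> e0; exists (Num.truncn e^-1).
by rewrite -ltf_pV2 ?posrE ?invr_gt0 ?ltr0n // invrK truncnS_gt.
Qed.

Lemma real_or_complex_inv_nat_null : inv_nat_null K.
Proof.
case: hK => ->; first exact: real_inv_nat.
move=> _ /complex_pos[e e0 ->]; have [n ne] := real_inv_nat e0; exists n.
by rewrite -ltcR in ne; apply: le_lt_trans ne; rewrite fmorphV rmorph_nat.
Qed.

Lemma separable_Banach_nonzero :
  exists X : completeNormedModType K, separable X /\ exists u : X, u != 0.
Proof.
have [a [Aa da]] : exists a : nat -> R, True /\ dense (range a).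
  have [a Aa] := countable_enum 0 (card_le_trans (card_image_le (@ratr R) setT)
    (countableP [set: rat])).
  exists a; split=> //; apply/dense_normP => x e e0.
  by have [_ /Aa[n _ <-] xa] := (dense_normP _).1 (@dense_rat R) x e e0; exists (a n).
case: hK => ->.
  exists (R^o : completeNormedModType R); split; last by exists 1; rewrite oner_neq0.
  exists (range a); split=> //; exact: card_le_trans (card_image_le _ _) (countableP setT).
exists (complex_line R); split; last by exists (1 : R[i]); exact: oner_neq0.
pose f (p : nat * nat) : complex_line R := (a p.1 +i* a p.2)%C.
exists (range f); split.
  exact: card_le_trans (card_image_le f _) (countableP setT).
apply/dense_normP => z _ /complex_pos[e e0 ->].
have e20 : 0 < e / 2 by rewrite divr_gt0.
have [_ [m _ <-] xm] := (dense_normP _).1 da (complex.Re z) _ e20.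
have [_ [n _ <-] xn] := (dense_normP _).1 da (complex.Im z) _ e20.
exists (f (m, n)); first by exists (m, n).
apply: le_lt_trans (normc_le_ReIm _) _; rewrite ltcR [e]splitr.
by case: z xm xn => x y /= xm xn; rewrite ltrD.
Qed.

End scalars.

(** * Operators on chains of norms *)

(* All the levels carry the vector space of sequences z : int -> Y, with the norm
   sup_i 2^-(d k i) |(z + e_0 kap k z) i| at level k. The map [to_coord k]
   identifies the completion of level k with c0 Y, and [step] is the identity
   map from level k + sigma to level k for all k. *)
Lemma scaler_linear_comb (K : numFieldType) (V : lmodType K) (a b : K) (u v : V) :
  a *: (b *: u) + b *: v = b *: (a *: u + v).
Proof. by rewrite scalerDr !scalerA mulrC. Qed.

Section levels.
Context {K : numFieldType} {Y : normedModType K}.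
Variables (d : int -> int -> nat) (c : int -> K) (s : int -> seq int).

Definition kap k (z : int -> Y) : Y := c k *: \sum_(i <- s k) z i.

Definition weight k i : K := 2 ^+ d k i.

Definition to_coord k (z : int -> Y) (i : int) : Y :=
  (weight k i)^-1 *: (if i == 0 then z 0 + kap k z else z i).

Definition unweight k (x : int -> Y) (i : int) : Y := weight k i *: x i.

(** The inverse of [to_coord]: as [kap k] ignores coordinate 0, it can be computed from the other
    coordinates and subtracted. *)
Definition of_coord k (x : int -> Y) (i : int) : Y :=
  if i == 0 then unweight k x 0 - kap k (unweight k x) else unweight k x i.

Hypothesis s_neq0 : forall k, 0 \notin s k.
Hypothesis d_lipschitz : forall k l i, absz (k - l) = 1%N -> (d l i <= (d k i).+1)%N.
Hypothesis kap_lipschitz : forall k l (z : int -> Y) (M : K), absz (k - l) = 1%N ->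
  0 <= M -> (forall i, `|z i| <= weight l i * M) -> `|kap k z - kap l z| <= 2 * M.

Lemma weight_gt0 k i : 0 < weight k i.
Proof. by rewrite exprn_gt0. Qed.

Lemma weight_norm k i : `|weight k i| = weight k i.
Proof. by rewrite ger0_norm // ltW // weight_gt0. Qed.

Lemma weightV_norm k i : `|(weight k i)^-1| = (weight k i)^-1.
Proof. by rewrite normfV weight_norm. Qed.

Lemma weight_neq0 k i : weight k i != 0.
Proof. by rewrite gt_eqF ?weight_gt0. Qed.

Lemma weightV_le1 k i : (weight k i)^-1 <= 1.
Proof. by rewrite invf_le1 ?weight_gt0 // exprn_ege1 // ler1n. Qed.

Lemma eq_kap k z z' : (forall i, i != 0 -> z i = z' i) -> kap k z = kap k z'.
Proof.
move=> zz; congr (_ *: _); apply: eq_big_seq => i si; apply: zz.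
by apply: contraNneq (s_neq0 k) => <-.
Qed.

Lemma kap_linear k a z z' :
  kap k (fun i => a *: z i + z' i) = a *: kap k z + kap k z'.
Proof.
by rewrite /kap big_split /= -scaler_sumr scaler_linear_comb.
Qed.

Lemma to_coord_linear k a z z' i :
  to_coord k (fun i => a *: z i + z' i) i = a *: to_coord k z i + to_coord k z' i.
Proof.
rewrite /to_coord kap_linear [RHS]scaler_linear_comb.
by congr (_ *: _); case: ifP => // _; rewrite [in RHS]scalerDr addrACA.
Qed.

Lemma of_coord_linear k a x x' i :
  of_coord k (fun i => a *: x i + x' i) i = a *: of_coord k x i + of_coord k x' i.
Proof.
have ul j : unweight k (fun i => a *: x i + x' i) j =
    a *: unweight k x j + unweight k x' j.
  by rewrite /unweight scaler_linear_comb.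
rewrite /of_coord !ul; case: ifP => // _.
rewrite (@eq_kap k _ (fun j => a *: unweight k x j + unweight k x' j)) //.
by rewrite kap_linear scalerBr opprD addrACA.
Qed.

Lemma to_coord0 k : to_coord k (fun=> 0) = fun=> 0.
Proof.
apply/funext => i; rewrite /to_coord /kap big1 // scaler0 addr0.
by case: ifP; rewrite scaler0.
Qed.

Lemma of_coord0 k : of_coord k (fun=> 0) = fun=> 0.
Proof.
apply/funext => i; rewrite /of_coord (@eq_kap k _ (fun=> 0)).
  by rewrite /unweight /kap big1 // !scaler0 subr0; case: ifP.
by move=> j _; rewrite /unweight scaler0.
Qed.

Lemma of_coordK k x : to_coord k (of_coord k x) = x.
Proof.
apply/funext => i; rewrite /to_coord /of_coord.
case: eqVneq => [->|i0]; last by rewrite /unweight scalerA mulVf ?weight_neq0 ?scale1r.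
rewrite eqxx (@eq_kap _ _ (unweight k x)) ?subrK.
  by rewrite /unweight scalerA mulVf ?weight_neq0 ?scale1r.
by move=> j /negPf ->.
Qed.

Lemma to_coordK k z : of_coord k (to_coord k z) = z.
Proof.
have uE i : unweight k (to_coord k z) i = if i == 0 then z 0 + kap k z else z i.
  by rewrite /unweight /to_coord scalerA mulfV ?weight_neq0 ?scale1r.
apply/funext => i; rewrite /of_coord !uE eqxx; case: eqVneq => [->|//].
rewrite (@eq_kap _ _ z) ?addrK // => j /negPf j0.
by rewrite uE j0.
Qed.

Lemma weight_ratio k l i : absz (k - l) = 1%N -> (weight k i)^-1 * weight l i <= 2.
Proof.
move=> kl; rewrite mulrC ler_pdivrMr ?weight_gt0 // -exprS.
by rewrite ler_weXn2l ?ler1n // d_lipschitz.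
Qed.

Lemma transition_le k l x i : absz (k - l) = 1%N -> i != 0 ->
  `|to_coord k (of_coord l x) i| <= 2 * `|x i|.
Proof.
move=> kl /negPf i0; rewrite /to_coord /of_coord i0 /unweight scalerA normrZ.
rewrite normrM weightV_norm weight_norm.
by rewrite ler_wpM2r // weight_ratio.
Qed.

(** At coordinate 0 the change of weight and the difference [kap k - kap l] contribute at most
    [2 * |x|] each, whence the constant 4. *)
Lemma transition_bound k l (x : c0 Y) i : absz (k - l) = 1%N ->
  `|to_coord k (of_coord l x) i| <= 4 * `|x|.
Proof.
move=> kl; have x_le j : `|x j| <= `|x| by exact: c0_norm_ge.
have [->|i0] := eqVneq i 0; last first.
  apply: le_trans (transition_le x kl i0) _.
  by apply: ler_pM; rewrite ?ler_nat.
rewrite /to_coord eqxx /of_coord eqxx (@eq_kap _ _ (unweight l x)); last first.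
  by move=> j /negPf ->.
rewrite -addrA [- _ + _]addrC scalerDr (le_trans (ler_normD _ _)) //.
rewrite (_ : 4 * `|x| = 2 * `|x| + 2 * `|x|); last by rewrite -mulrDl -natrD.
rewrite lerD //.
  rewrite /unweight scalerA normrZ.
  rewrite normrM weightV_norm weight_norm.
  by rewrite ler_pM ?weight_ratio // mulr_ge0 ?invr_ge0 // ltW ?weight_gt0.
rewrite normrZ -[leRHS]mul1r ler_pM //.
  by rewrite weightV_norm weightV_le1.
apply: kap_lipschitz => // j; rewrite /unweight normrZ.
by rewrite weight_norm ler_wpM2l // ltW // weight_gt0.
Qed.

Section step.
Variable sigma : int.
Hypothesis sigma1 : absz sigma = 1%N.

Let dist_sigma k : absz (k - (k + sigma))%R = 1%N.
Proof. by lia. Qed.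

Lemma transition_subproof k (x : c0 Y) :
  to_coord k (of_coord (k + sigma) x) \in @c0_pred K Y.
Proof.
apply: c0_pred_tail => e e0; have e20 : 0 < e / 2 by rewrite divr_gt0.
have [N hN] := c0_tail x e20; exists N.+1 => i Ni.
have i0 : i != 0 by lia.
apply: le_lt_trans (transition_le x (dist_sigma k) i0) _.
by rewrite mulrC -ltr_pdivlMr // hN // ltnW.
Qed.

Definition transition k (x : c0 Y) : c0 Y := C0 (transition_subproof k x).

Lemma transition_norm k x : `|transition k x| <= 4 * `|x|.
Proof. by apply: c0_norm_le => i; exact: transition_bound. Qed.

Lemma step_subproof (x : c0 (c0 Y)) :
  (fun k => transition k (x (k + sigma))) \in @c0_pred K (c0 Y).
Proof.
apply: c0_pred_tail => e e0; have e20 : 0 < e / 4 by rewrite divr_gt0.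
have [N hN] := c0_tail x e20; exists N.+1 => k Nk.
apply: le_lt_trans (transition_norm _ _) _.
rewrite mulrC -ltr_pdivlMr // hN //; lia.
Qed.

Definition step_fun (x : c0 (c0 Y)) : c0 (c0 Y) := C0 (step_subproof x).

Lemma step_linear : linear step_fun.
Proof.
move=> a x y; apply: c0P => k; apply: c0P => i /=.
apply: etrans (to_coord_linear k a (of_coord (k + sigma) (x (k + sigma)))
  (of_coord (k + sigma) (y (k + sigma))) i).
congr (to_coord _ _ _); apply/funext => j; exact: of_coord_linear.
Qed.

HB.instance Definition _ :=
  GRing.isLinear.Build K (c0 (c0 Y)) (c0 (c0 Y)) *:%R step_fun step_linear.

Lemma step_bounded : bounded_near step_fun (nbhs (0 : c0 (c0 Y))).
Proof.
apply/(linear_boundedP step_fun); near=> r => x.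
have r4 : 4 <= r by near: r; apply: nbhs_pinfty_ge.
apply: c0_norm_le => k; apply: le_trans (transition_norm _ _) _.
by apply: ler_pM => //; exact: c0_norm_ge.
Unshelve. all: by end_near. Qed.

Definition step : bounded_operator (c0 (c0 Y)) := BoundedOperator step_bounded.

(** The intermediate changes of coordinates cancel, since all levels represent the same sequence. *)
Lemma iter_stepE n (x : c0 (c0 Y)) k :
  iter n step x k = to_coord k (of_coord (k + sigma * n%:Z) (x (k + sigma * n%:Z))) :> (int -> Y).
Proof.
elim: n k => [|n IH] k; first by rewrite mulr0 addr0 of_coordK.
have -> : (iter n.+1 step x k : int -> Y) =
  to_coord k (of_coord (k + sigma) (iter n step x (k + sigma))) by [].
rewrite IH to_coordK.
by have -> : k + sigma + sigma * n%:Z = k + sigma * n.+1%:Z by lia.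
Qed.

End step.
End levels.

Section sites.
Context {K : numFieldType} {Y : normedModType K}.
Variables (d : int -> int -> nat) (c : int -> K) (s : int -> seq int).
Hypothesis s_neq0 : forall k, 0 \notin s k.
Hypothesis d_lipschitz : forall k l i, absz (k - l) = 1%N -> (d l i <= (d k i).+1)%N.
Hypothesis kap_lipschitz : forall k l (z : int -> Y) (M : K), absz (k - l) = 1%N ->
  0 <= M -> (forall i, `|z i| <= weight d l i * M) ->
  `|kap c s k z - kap c s l z| <= 2 * M.

Notation kap := (kap c s).
Notation to_coord := (to_coord d c s).
Notation of_coord := (of_coord d c s).
Notation weight := (weight d).
Notation T h := (step s_neq0 d_lipschitz kap_lipschitz h).

Definition unit_seq (i : int) (y : Y) (j : int) : Y := if j == i then y else 0.

Definition coef k i : K := c k * (count_mem i (s k))%:R.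

Lemma kap_unit_seq k i y : kap k (unit_seq i y) = coef k i *: y.
Proof.
rewrite /kap /coef -scalerA; congr (_ *: _).
elim: (s k) => [|j t IH]; first by rewrite big_nil scale0r.
rewrite big_cons IH /unit_seq /= natrD scalerDl.
by case: ifP; rewrite ?scale1r ?scale0r.
Qed.

Lemma coef0 k : coef k 0 = 0.
Proof. by rewrite /coef (count_memPn (s_neq0 k)) mulr0. Qed.

Lemma to_coord_unit_seq k i y j : to_coord k (unit_seq i y) j =
  (weight k j)^-1 *: (if j == i then y else if j == 0 then coef k i *: y else 0).
Proof.
rewrite /to_coord kap_unit_seq /unit_seq; congr (_ *: _).
have [->|//] := eqVneq j 0.
by case: eqVneq => [<-|]; rewrite ?coef0 ?scale0r ?addr0 ?add0r.
Qed.

Lemma site_subproof k i y : to_coord k (unit_seq i y) \in @c0_pred K Y.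
Proof.
apply: (@c0_pred_finite _ _ _ `|i|.+1) => j ij; rewrite to_coord_unit_seq.
have -> : (j == i) = false by apply/eqP => ji; move: ij; rewrite ji ltnn.
have -> : (j == 0) = false by apply/eqP => j0; move: ij; rewrite j0.
by rewrite scaler0.
Qed.

(* The vector y e_i of level k, whose coordinates are to_coord k (y e_i). *)
Definition site k i (y : Y) : c0 (c0 Y) := c0_single k (C0 (site_subproof k i y)).

Lemma siteE k i y : site k i y k = to_coord k (unit_seq i y) :> (int -> Y).
Proof. by rewrite /site /= eqxx. Qed.

Lemma siteN k i y : site k i (- y) = - site k i y.
Proof.
rewrite -c0_singleN; congr c0_single; apply: c0P => j; rewrite c0N /=.
rewrite !to_coord_unit_seq -scalerN; congr (_ *: _).
by case: ifP => // _; case: ifP; rewrite ?scalerN ?oppr0.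
Qed.

(** The point of the pair is that [y'] can cancel the contribution of [y] to the distinguished
    coordinate. *)
Lemma site_pair_lt k i y y' M : i != 0 -> (weight k i)^-1 * `|y| < M ->
  (weight k 0)^-1 * `|y' + coef k i *: y| < M ->
  `|site k i y + site k 0 y'| < M.
Proof.
move=> i0 h1 h2; rewrite -c0_singleD c0_single_norm; apply: c0_norm_lt => j.
rewrite c0D /= !to_coord_unit_seq -scalerDr normrZ weightV_norm.
have M0 : 0 < M.
  by apply: le_lt_trans h1; rewrite mulr_ge0 // invr_ge0 ltW ?weight_gt0.
have [->|ji] := eqVneq j i; first by rewrite (negPf i0) addr0.
have [->|j0] := eqVneq j 0; first by rewrite addrC.
by rewrite addr0 normr0 mulr0.
Qed.

Lemma site_lt k i y M : (weight k i)^-1 * `|y| < M ->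
  (weight k 0)^-1 * `|coef k i *: y| < M -> `|site k i y| < M.
Proof.
move=> h1 h2; rewrite c0_single_norm; apply: c0_norm_lt => j.
rewrite /= to_coord_unit_seq normrZ weightV_norm.
have M0 : 0 < M.
  by apply: le_lt_trans h1; rewrite mulr_ge0 // invr_ge0 ltW ?weight_gt0.
have [->//|ji] := eqVneq j i.
by case: eqVneq => [->//|_]; rewrite normr0 mulr0.
Qed.

Lemma site_ind (P : c0 (c0 Y) -> Prop) :
  (forall x y, P x -> P y -> P (x + y)) ->
  (forall x, (forall e : K, 0 < e -> exists2 y, P y & `|x - y| < e) -> P x) ->
  (forall k i y, P (site k i y)) -> forall x, P x.
Proof.
move=> PD Pc P1; apply: nested_c0_ind => // k i u.
have wK j y : (weight k j)^-1 *: (weight k j *: y) = y.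
  by rewrite scalerA mulVf ?weight_neq0 ?scale1r.
have [->|i0] := eqVneq i 0.
  suff -> : c0_single k (c0_single 0 u) = site k 0 (weight k 0 *: u) by [].
  congr c0_single; apply: c0P => j; rewrite c0_singleE /= to_coord_unit_seq.
  by case: eqVneq => [->|]; rewrite ?wK ?scaler0.
(* The second site removes what the first one adds to the distinguished coordinate. *)
suff -> : c0_single k (c0_single i u) = site k i (weight k i *: u) +
    site k 0 (- (coef k i *: (weight k i *: u))) by exact: PD.
rewrite -c0_singleD; congr c0_single; apply: c0P => j.
rewrite c0D c0_singleE /= !to_coord_unit_seq -scalerDr.
have [->|ji] := eqVneq j i; first by rewrite (negPf i0) addr0 wK.
by case: eqVneq => [->|_]; rewrite ?subrr ?addr0 scaler0.
Qed.

(** The entry [z_0] of the sequence at level 0. It is the bounded linear map whose vanishing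
    obstructs density. *)
Definition base (x : c0 (c0 Y)) : Y := of_coord 0 (x 0) 0.

Lemma baseB x y : base (x - y) = base x - base y.
Proof.
have := of_coord_linear d c s_neq0 0 (-1) (y 0) (x 0) 0; rewrite scaleN1r addrC => <-.
by congr (of_coord _ _ _); apply/funext => i; rewrite scaleN1r addrC.
Qed.

Lemma base_site y : base (site 0 0 y) = y.
Proof. by rewrite /base siteE to_coordK. Qed.

Lemma base_bounded : exists2 M : K, 0 < M & forall x, `|base x| <= M * `|x|.
Proof.
exists (weight 0 0 + `|c 0| * \sum_(i <- s 0) weight 0 i).
  rewrite ltr_pwDl ?weight_gt0 // mulr_ge0 // sumr_ge0 // => i _.
  by rewrite ltW ?weight_gt0.
move=> x; have xle i : `|weight 0 i *: x 0 i| <= weight 0 i * `|x|.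
  rewrite normrZ weight_norm ler_wpM2l ?(ltW (weight_gt0 _ _ _)) //.
  exact: le_trans (c0_norm_ge (x 0) i) (c0_norm_ge x 0).
rewrite /base /of_coord eqxx (le_trans (ler_normB _ _)) // mulrDl lerD //.
  exact: xle.
rewrite normrZ -mulrA ler_wpM2l // mulr_suml.
apply: le_trans (ler_norm_sum _ _ _) _; apply: ler_sum => i _; exact: xle.
Qed.

Lemma base_null_not_dense (A : set (c0 (c0 Y))) (y : Y) : y != 0 ->
  (forall x, A x -> base x = 0) -> ~ dense A.
Proof.
move=> y0 Ab /dense_normP dA; have [M M0 hM] := base_bounded.
have y0' : 0 < `|y| / M by rewrite divr_gt0 ?normr_gt0.
have [x /Ab x0 yx] := dA (site 0 0 y) _ y0'.
have := hM (site 0 0 y - x); rewrite baseB base_site x0 subr0.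
by move=> /le_lt_trans/(_ (_ : _ < `|y|)); rewrite ltxx mulrC -ltr_pdivlMr // => /(_ yx).
Qed.

Lemma iter_step_site sigma (h : absz sigma = 1%N) n k i y :
  iter n (T h) (site k i y) = site (k - sigma * n%:Z) i y.
Proof.
apply: c0P => j; apply: c0P => l; rewrite iter_stepE.
have [jk|jk] := eqVneq (j + sigma * n%:Z) k.
  by rewrite jk siteE to_coordK // -jk addrK siteE.
have -> : (site k i y (j + sigma * n%:Z) : int -> Y) = fun=> 0.
  by apply/funext => m; rewrite /= (negPf jk).
rewrite of_coord0 // to_coord0 /=.
have -> // : (j == k - sigma * n%:Z) = false.
by apply/eqP => E; move: jk; rewrite E subrK eqxx.
Qed.

Lemma step_inv sigma tau (h : absz sigma = 1%N) (h' : absz tau = 1%N) :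
  sigma + tau = 0 -> forall x, T h (T h' x) = x.
Proof.
move=> st x; apply: c0P => k; apply: c0P => i.
have -> : T h (T h' x) k i = to_coord k (of_coord (k + sigma)
  (to_coord (k + sigma) (of_coord (k + sigma + tau) (x (k + sigma + tau))))) i by [].
by rewrite to_coordK // -addrA st addr0 of_coordK.
Qed.

(** The iterate carries the level 0 sequence of [x] to level [- (sigma * n)], where its
    distinguished coordinate is undamped and so bounds the norm from below. *)
Lemma iter_step_base sigma (h : absz sigma = 1%N) n x :
  d (- (sigma * n%:Z)) 0 = 0%N ->
  `|base x + kap (- (sigma * n%:Z)) (of_coord 0 (x 0))| <= `|iter n (T h) x|.
Proof.
move=> d0.
apply: le_trans (c0_norm_ge (iter n (T h) x) (- (sigma * n%:Z))).
apply: le_trans (c0_norm_ge (iter n (T h) x (- (sigma * n%:Z))) 0).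
rewrite iter_stepE addNr /to_coord eqxx normrZ weightV_norm.
by rewrite /weight d0 expr0 invr1 mul1r.
Qed.

End sites.

(** * Null vectors of an invertible operator and of its inverse *)

Definition stable_set (X : topologicalType) (x0 : X) (T : X -> X) : set X :=
  [set x | iter n T x @[n --> \oo] --> x0].

Section invertible_pairs.
Context {K : numFieldType} {X : normedModType K}.
Variables T S : bounded_operator X.
Hypotheses (TS : forall x, T (S x) = x) (ST : forall x, S (T x) = x).

Lemma stable_setD x y : stable_set 0 T x -> stable_set 0 T y ->
  stable_set 0 T (x + y).
Proof.
move=> hx hy; rewrite /stable_set /=.
under eq_fun do rewrite iter_linearD.
by rewrite -[0 : X]addr0; exact: cvgD.
Qed.

Lemma iter_rinv n x : iter n T (iter n S x) = x.
Proof. by elim: n => // n IH; rewrite iterSr iterS TS. Qed.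

Lemma iter_linv n x : iter n S (iter n T x) = x.
Proof. by elim: n => // n IH; rewrite iterSr iterS ST. Qed.

Lemma stable_dense_Kitai : dense (stable_set 0 T) -> dense (stable_set 0 S) ->
  satisfies T Kitai.
Proof.
move=> dT dS; exists (stable_set 0 T), (stable_set 0 S); split=> //.
exists S; split=> // y; rewrite /stable_set /= => hy.
have -> : (fun n => iter n S (S y)) = (fun n => iter (n + 1)%N S y).
  by apply/funext => n; rewrite addn1 iterSr.
by rewrite (cvg_shiftn 1 (fun n => iter n S y)).
Qed.

(** Any section [R] has the iterates of the inverse: [R^n y = S^n (T^n (R^n y)) = S^n y]. *)
Lemma Kitai_stable_subset X0 Y0 : Kitai_criterion_for T X0 Y0 ->
  X0 `<=` stable_set 0 T /\ Y0 `<=` stable_set 0 S.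
Proof.
move=> [_ _ [R [RY T0 R0 TR]]]; split=> // y Yy; rewrite /stable_set /=.
suff -> : (fun n => iter n S y) = (fun n => iter n R y) by exact: R0.
apply/funext => n; have [_ {1}<-] := Kitai_section_iter n RY TR Yy.
by rewrite iter_linv.
Qed.

Lemma dense_subset (A B : set X) : A `<=` B -> dense A -> dense B.
Proof. by move=> AB dA U U0 /(dA _ U0)[x [Ux /AB]]; exists x. Qed.

Lemma HC_stable_dense : satisfies T HC -> dense (stable_set 0 T).
Proof. by move=> [X0 [Y0 [dX _ [R [T0 _ _]]]]]; exact: dense_subset dX. Qed.

Lemma pair_mixing : (forall x, nearly_null T x) -> dense (stable_set 0 S) ->
  mixing T.
Proof.
move=> hT /dense_normP dS; apply/mixingP; split=> // x.
apply: nearly_reached_closed => e e0; have [y Sy xy] := dS x e e0.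
exists y => // r r0; have /cvg0_normP/(_ _ r0) := Sy.
by apply: filterS => n h; exists (iter n S y); rewrite // iter_rinv subrr normr0.
Qed.

(** If [T^n x'] is small and [x'] is near [x], then [S^n] maps the small vector [T^n x'] to [x']. *)
Lemma pair_inverse_mixing : (forall x, nearly_null T x) ->
  dense (stable_set 0 S) -> mixing S.
Proof.
move=> hT /dense_normP dS; apply/mixingP; split=> x.
  apply: nearly_null_closed => e e0; have [y Sy xy] := dS x e e0.
  by exists y => //; exact: null_nearly_null.
move=> e e0; apply: filterS (hT x e e0) => n [x' xx' Tx'].
by exists (iter n T x'); rewrite // iter_linv.
Qed.

End invertible_pairs.

Lemma pow2_small (K : numFieldType) : inv_nat_null K -> forall M e : K,
  0 <= M -> 0 < e -> exists N, forall m, (N <= m)%N -> (2 ^+ m)^-1 * M < e.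
Proof.
move=> hK M e M0 e0; have M1 : 0 < M + 1 by rewrite ltr_wpDl.
have [n ne] := hK (e / (M + 1)) (divr_gt0 e0 M1); exists n => m nm.
have h : (2 ^+ m)^-1 <= n.+1%:R^-1 :> K.
  rewrite lef_pV2 ?posrE ?exprn_gt0 ?ltr0n // -natrX ler_nat.
  exact: leq_ltn_trans nm (ltn_expl _ _).
have := ltr_pM2r M1 n.+1%:R^-1 (e / (M + 1)); rewrite ne divfK ?gt_eqF // => ne'.
by apply: le_lt_trans ne'; apply: ler_pM => //; rewrite lerDl.
Qed.

Lemma dense_sites (K : numFieldType) (Y : normedModType K)
    (d : int -> int -> nat) (c : int -> K) (s : int -> seq int)
    (s_neq0 : forall k, 0 \notin s k) (A : set (c0 (c0 Y))) :
  (forall x y, A x -> A y -> A (x + y)) ->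
  (forall k i (y : Y) (e : K), 0 < e ->
    exists2 x, A x & `|site d c s_neq0 k i y - x| < e) -> dense A.
Proof.
move=> AD Asite.
apply/dense_normP; apply: (site_ind (d := d) (c := c) (s_neq0 := s_neq0)).
- move=> x y hx hy e e0; have e20 : 0 < e / 2 by rewrite divr_gt0.
  have [v Av xv] := hx _ e20; have [w Aw yw] := hy _ e20.
  by exists (v + w); [exact: AD|rewrite opprD addrACA norm_lt2D].
- move=> x hx e e0; have e20 : 0 < e / 2 by rewrite divr_gt0.
  have [y hy xy] := hx _ e20; have [z zv yz] := hy _ e20.
  by exists z => //; exact: dist_lt2D xy yz.
- exact: Asite.
Qed.

(** * Kitai criterion without a common dense set *)

(* At level k < 0 the distinguished coordinate is z_0 + (z_1 + ... + z_|k|), at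
   level k >= 0 it is z_0 - (z_1 + ... + z_k): a vector that tends to 0 in both
   directions has z_0 + sum_(i > 0) z_i = 0 = z_0 - sum_(i > 0) z_i. *)
Section opposite_sums.
Context {K : numFieldType} {Y : normedModType K}.
Hypothesis hK : inv_nat_null K.

(** Off coordinate 0, the distance from [|k|] to [|i|]. For [i > 0] the entry [z_i] joins the sum
    between [|k| = i - 1] and [|k| = i], where its weight is 2 and 1. *)
Definition cone_weight (k i : int) : nat :=
  if i == 0 then 0%N else ((`|k| - `|i|) + (`|i| - `|k|))%N.

Definition side_sign (k : int) : K := if k < 0 then 1 else -1.

Definition initial_segment (k : int) : seq int := [seq n%:Z | n <- iota 1 `|k|].

Notation ksum := (kap (Y := Y) side_sign initial_segment).

Lemma mem_initial_segment k i : (i \in initial_segment k) = (0 < i) && (i <= `|k|%N%:Z).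
Proof.
apply/mapP/idP => [[n]|ik]; first by rewrite mem_iota => nk ->; lia.
by exists (absz i); rewrite ?mem_iota; lia.
Qed.

Lemma initial_segment_neq0 k : 0 \notin initial_segment k.
Proof. by rewrite mem_initial_segment. Qed.

Lemma cone_weight_lipschitz k l i : absz (k - l) = 1%N ->
  (cone_weight l i <= (cone_weight k i).+1)%N.
Proof. by rewrite /cone_weight; case: eqVneq => // _; lia. Qed.

Lemma ksumS k l z : absz (k - l) = 1%N -> absz k = (absz l).+1 ->
  ksum k z - ksum l z = side_sign k *: z `|k|%N%:Z.
Proof.
move=> kl akl; rewrite /kap /initial_segment akl -[(absz l).+1]addn1 iotaD map_cat big_cat /=.
rewrite big_seq1 scalerDr add1n addn1.
(* The sign jumps between levels -1 and 0, harmlessly because the sum of level 0 is empty. *)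
have [l0|l0] := eqVneq l 0.
  by rewrite l0 /= !big_nil !scaler0 add0r subr0.
have -> : side_sign k = side_sign l by rewrite /side_sign; congr (if _ then _ else _); lia.
by rewrite addrAC subrr add0r.
Qed.

Lemma ksum_lipschitz k l z (M : K) : absz (k - l) = 1%N -> 0 <= M ->
  (forall i, `|z i| <= weight cone_weight l i * M) ->
  `|ksum k z - ksum l z| <= 2 * M.
Proof.
move=> kl M0 zM.
have sgn j (y : Y) : `|side_sign j *: y| = `|y|.
  by rewrite normrZ /side_sign; case: ifP; rewrite ?normrN normr1 mul1r.
have [akl|alk] : absz k = (absz l).+1 \/ absz l = (absz k).+1 by lia.
  rewrite ksumS // sgn (le_trans (zM _)) // ler_wpM2r //.
  rewrite /weight /cone_weight /=; case: ifP => _; first by rewrite expr0 ler1n.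
  by rewrite (_ : (_ + _)%N = 1%N) ?expr1 //; lia.
rewrite distrC ksumS //; last by lia.
rewrite sgn (le_trans (zM _)) // ler_wpM2r //.
rewrite /weight /cone_weight /=; case: ifP => _; first by rewrite expr0 ler1n.
by rewrite (_ : (_ + _)%N = 0%N) ?expr0 ?ler1n //; lia.
Qed.

Notation T h := (step initial_segment_neq0 cone_weight_lipschitz ksum_lipschitz h).
Notation site := (site (Y := Y) cone_weight side_sign initial_segment_neq0).

Lemma coef_initial_segment k i : coef side_sign initial_segment k i =
  if (0 < i) && (i <= `|k|%N%:Z) then side_sign k else 0.
Proof.
rewrite /coef count_uniq_mem; last by rewrite map_inj_uniq ?iota_uniq // => a b [].
by rewrite mem_initial_segment; case: ifP; rewrite ?mulr1 ?mulr0.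
Qed.

Section direction.
Variable sigma : int.
Hypothesis h : absz sigma = 1%N.

Let sigmaE : sigma = 1 \/ sigma = -1. Proof. by lia. Qed.

Let sgn : K := if 0 < sigma then 1 else -1.

Let sgn2 (y : Y) : sgn *: (sgn *: y) = y.
Proof. by rewrite scalerA /sgn; case: ifP; rewrite ?mulr1 ?mulrNN ?mulr1 scale1r. Qed.

Let side_sign_far k n : (`|k| < n)%N -> side_sign (k - sigma * n%:Z) = sgn.
Proof.
move=> kn; rewrite /side_sign /sgn.
have [->|->] := sigmaE.
  by rewrite (_ : _ < 0) //; lia.
by rewrite ifF //; lia.
Qed.

Let weight_far k i (y : Y) (e : K) : i != 0 -> 0 < e -> exists N, forall n, (N <= n)%N ->
  (weight cone_weight (k - sigma * n%:Z) i)^-1 * `|y| < e.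
Proof.
move=> i0 e0; have [N hN] := pow2_small hK (normr_ge0 y) e0.
exists (N + `|k| + `|i|)%N => n Nn; apply: hN.
by rewrite /cone_weight (negPf i0); case: sigmaE => ->; lia.
Qed.

Lemma stable_site_neg k i y : i < 0 -> stable_set 0 (T h) (site k i y).
Proof.
move=> i0; apply/cvg0_normP => e e0.
have [|N hN] := @weight_far k i y e _ e0; first by lia.
exists N => // n /= Nn; rewrite iter_step_site; apply: site_lt; first exact: hN.
by rewrite coef_initial_segment ltNge (ltW i0) /= scale0r normr0 mulr0.
Qed.

(** Once [|k - sigma * n|] reaches [i], the contribution of [z_i] to the distinguished coordinate is
    [sgn *: y], which the second site cancels; coordinate [i] itself is damped. *)
Lemma stable_site_pos k i y : 0 < i ->
  stable_set 0 (T h) (site k i y + site k 0 (- (sgn *: y))).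
Proof.
move=> i0; apply/cvg0_normP => e e0; have i0' : i != 0 by rewrite gt_eqF.
have [N hN] := weight_far k y i0' e0; exists (N + `|k| + `|i|).+1%N => // n Nn.
have {}Nn : (_ < n)%N := Nn.
rewrite iter_linearD !iter_step_site; apply: site_pair_lt => //.
  by apply: hN; lia.
rewrite coef_initial_segment side_sign_far; last by lia.
rewrite ifT ?addNr ?normr0 ?mulr0 //.
by case: sigmaE => ->; lia.
Qed.

Lemma stable_opposite_sums_dense : dense (stable_set 0 (T h)).
Proof.
have stD := @stable_setD _ _ (T h).
have site0 k y e : 0 < e -> exists2 x, stable_set 0 (T h) x & `|site k 0 y - x| < e.
  move=> e0; have [N hN] := pow2_small hK (normr_ge0 (sgn *: y)) e0.
  (* Beyond [|k|] the index does not enter the sum of level [k], and its depth there is [N + 1], so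
     the correction at [i] is small. *)
  pose i := (N + `|k|).+1%:Z; have i0 : 0 < i by [].
  exists (site k i (- (sgn *: y)) + site k 0 (- (sgn *: - (sgn *: y)))).
    exact: stable_site_pos.
  rewrite scalerN opprK sgn2 opprD addrCA subrr addr0 siteN opprK.
  apply: site_lt; first by apply: hN; rewrite /cone_weight /=; lia.
  rewrite coef_initial_segment ifF ?scale0r ?normr0 ?mulr0 //.
  by rewrite /i; lia.
apply: (dense_sites (s_neq0 := initial_segment_neq0) (c := side_sign)
  (d := cone_weight) stD) => k i y e e0.
have [i0|i0|->] := ltgtP i 0; last exact: site0.
  exists (site k i y); first exact: stable_site_neg.
  by rewrite subrr normr0.
have [x xs hx] := site0 k (sgn *: y) e e0.
exists (site k i y + site k 0 (- (sgn *: y)) + x).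
  by apply: stD => //; exact: stable_site_pos.
by rewrite siteN -addrA [- _ + _]addrC opprD addrA subrr sub0r opprB.
Qed.

End direction.

Lemma stable_both_base0 (h : absz 1 = 1%N) (h' : absz (-1) = 1%N) x :
  stable_set 0 (T h) x -> stable_set 0 (T h') x ->
  base cone_weight side_sign initial_segment x = 0.
Proof.
move=> /cvg0_normP hx /cvg0_normP hx'; apply/eqP; rewrite -normr_le0.
apply/ler_addgt0Pr => e e0; rewrite add0r.
(* [n >= 1] is required because level 0 has the sign of the positive side. *)
have [n [/= nx [nx' n0]]] := filter_ex (filterI (hx e e0) (filterI (hx' e e0)
  (nbhs_infty_ge 1))).
pose z := of_coord cone_weight side_sign initial_segment 0 (x 0).
pose S := \sum_(i <- initial_segment n) z i.
have e1 : ksum (- (1 * n%:Z)) z = S.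
  rewrite /kap /side_sign /S mul1r ifT ?scale1r; last by lia.
  by congr (\sum_(i <- _) _); rewrite /initial_segment abszN.
have e2 : ksum (- (-1 * n%:Z)) z = - S.
  by rewrite /kap /side_sign /S mulN1r opprK scaleN1r.
have h1 := iter_step_base initial_segment_neq0 cone_weight_lipschitz
  ksum_lipschitz h (n := n) x erefl.
have h2 := iter_step_base initial_segment_neq0 cone_weight_lipschitz
  ksum_lipschitz h' (n := n) x erefl.
move: (le_lt_trans h1 nx) (le_lt_trans h2 nx').
rewrite -/z e1 e2; set b := base _ _ _ _ => hp hm.
have : `|(b + S) + (b - S)| <= e + e.
  by rewrite (le_trans (ler_normD _ _)) // lerD // ltW.
by rewrite addrACA subrr addr0 -mulr2n -[e + e]mulr2n normrMn ler_pMn2r.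
Qed.

Lemma opposite_sums_Kitai (y : Y) : y != 0 ->
  exists T : bounded_operator (c0 (c0 Y)),
    satisfies T Kitai /\ ~ satisfies T Kitai_same_set.
Proof.
move=> y0; have h : absz 1 = 1%N by []. have h' : absz (-1) = 1%N by [].
have TS x : T h (T h' x) = x by apply: step_inv.
have ST x : T h' (T h x) = x by apply: step_inv.
exists (T h); split.
  exact: stable_dense_Kitai TS (stable_opposite_sums_dense h)
    (stable_opposite_sums_dense h').
move=> [X0 hX0]; have [dX _ _] := hX0.
have [XT XS] := Kitai_stable_subset ST hX0.
apply: (base_null_not_dense initial_segment_neq0 y0 _ dX) => x Xx.
exact: stable_both_base0 (XT _ Xx) (XS _ Xx).
Qed.

End opposite_sums.

(** * A mixing operator with few null vectors *)

Lemma trunc_log2S n : trunc_log 2 n.+1 = trunc_log 2 n \/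
  (n.+1 = 2 ^ (trunc_log 2 n).+1 /\ trunc_log 2 n.+1 = (trunc_log 2 n).+1)%N.
Proof.
case: n => [|n]; first by left.
have /andP[h1 h2] := trunc_log_bounds (isT : 1 < 2)%N (isT : 0 < n.+1)%N.
move: h2; rewrite leq_eqVlt => /orP[/eqP E|lt]; [right|left].
  by rewrite E trunc_expnK.
by apply: trunc_log_eq => //; rewrite lt (leq_trans h1).
Qed.

(* For j = trunc_log 2 n the distinguished coordinate at level -n is
   z_0 + z_j if j is odd, z_0 + z_(j-1) + z_(j+1) if j is even, so that for odd j
   z_0 = (z_0 + z_j) - (z_0 + z_j + z_(j+2)) + (z_0 + z_(j+2)) vanishes on the
   vectors that tend to 0. The coordinate i has weight about 1 near the levels
   -2^(i-1) and -2^(i+2), where z_i enters or leaves the sum, and is damped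
   exponentially in the distance to them. *)
Section lacunary.
Context {K : numFieldType} {Y : normedModType K}.

Definition distn (a b : nat) : nat := ((a - b) + (b - a))%N.

Definition lacunary_depth (n : nat) (i : int) : nat :=
  if i == 0 then 0%N
  else minn (distn n (2 ^ `|i|.-1)) (distn n (2 ^ `|i|.+2)).

Definition neg_level (k : int) : nat := if k is Negz n then n.+1 else 0%N.

(** At levels [k >= 0] the extra exponent damps every coordinate, the distinguished one included, so
    the inverse operator sends every site to 0. *)
Definition lacunary_weight (k i : int) : nat :=
  (lacunary_depth (neg_level k) i + (if k is Posz n then n else 0))%N.

Definition log_window (n : nat) : seq int :=
  let j := trunc_log 2 n in
  if odd j then [:: j%:Z] else [:: j%:Z - 1; j%:Z + 1].

Definition lacunary_support (k : int) : seq int := log_window (neg_level k).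

Notation lsum := (kap (Y := Y) (fun=> 1 : K) lacunary_support).

Lemma log_window_neq0 n : 0 \notin log_window n.
Proof.
rewrite /log_window; case: ifP => [|jo]; rewrite !inE; first by case: trunc_log.
by case: (trunc_log 2 n) jo => [|[|j]] //= _; lia.
Qed.

Lemma lacunary_support_neq0 k : 0 \notin lacunary_support k.
Proof. exact: log_window_neq0. Qed.

Lemma lacunary_depth_lipschitz m n i : (m <= n.+1)%N -> (n <= m.+1)%N ->
  (lacunary_depth n i <= (lacunary_depth m i).+1)%N.
Proof.
rewrite /lacunary_depth /distn; case: ifP => // _.
by move: (2 ^ _)%N (2 ^ _)%N => a b; lia.
Qed.

Lemma lacunary_weight_lipschitz k l i : absz (k - l) = 1%N ->
  (lacunary_weight l i <= (lacunary_weight k i).+1)%N.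
Proof.
move=> kl; rewrite /lacunary_weight.
have [[k0 [l0 n0]]|[k0 [l0 n0]]] :
    (0 <= k /\ 0 <= l /\ True) \/ (k <= 0 /\ l <= 0 /\ True) by lia.
  case: k k0 kl => // k _; case: l l0 => // l _ kl /=; lia.
have := @lacunary_depth_lipschitz (neg_level k) (neg_level l) i.
case: k k0 kl => [[|k]|k] //= _; case: l l0 => [[|l]|l] //= _ kl; lia.
Qed.

Lemma lacunary_depth_le1 n i :
  (distn n (2 ^ `|i|.-1) <= 1)%N \/ (distn n (2 ^ `|i|.+2) <= 1)%N ->
  (lacunary_depth n i <= 1)%N.
Proof. by rewrite /lacunary_depth; case: ifP => // _; rewrite geq_min => /orP. Qed.

Definition window_sum (n : nat) (z : int -> Y) : Y := \sum_(i <- log_window n) z i.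

(* The index entering or leaving the window between n and n.+1 has depth at most 1
   at both. *)
Lemma window_sumS n z : window_sum n.+1 z = window_sum n z \/
  exists i, [/\ (lacunary_depth n i <= 1)%N, (lacunary_depth n.+1 i <= 1)%N &
    window_sum n.+1 z = window_sum n z + z i \/
    window_sum n z = window_sum n.+1 z + z i].
Proof.
rewrite /window_sum /log_window.
have [->|[nE ->]] := trunc_log2S n; first by left.
move: (trunc_log 2 n) nE => j nE; right.
have [jo|je] := boolP (odd j); rewrite /= ?jo ?(negPf je) /=.
  have nE' : n.+1 = (2 ^ (absz (j%:Z + 2)%R).-1)%N by rewrite nE; congr (2 ^ _)%N; lia.
  exists (j%:Z + 2); split; [apply: lacunary_depth_le1; left..|].
  - by rewrite -nE' /distn; lia.
  - by rewrite -nE' /distn; lia.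
  left; rewrite big_cons !big_seq1.
  by congr (z _ + z _); lia.
exists (j%:Z - 1); split; [apply: lacunary_depth_le1..|].
(* For [j = 0] the index that leaves is -1. It leaves between 1 and 2, close to its entry point
   [2 ^ 0] and not to [2 ^ 3]. *)
- have [j0|j0] := eqVneq j 0%N; [left|right].
    by move: nE; rewrite j0 /= expn1 => -[->].
  suff <- : n.+1 = (2 ^ (absz (j%:Z - 1)%R).+2)%N by rewrite /distn; lia.
  by rewrite nE; congr (2 ^ _)%N; lia.
- have [j0|j0] := eqVneq j 0%N; [left|right].
    by move: nE; rewrite j0 /= expn1 => -[->].
  suff <- : n.+1 = (2 ^ (absz (j%:Z - 1)%R).+2)%N by rewrite /distn; lia.
  by rewrite nE; congr (2 ^ _)%N; lia.
right; rewrite big_cons !big_seq1 addrC; congr (z _ + z _); lia.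
Qed.

Lemma lsum_window k z : lsum k z = window_sum (neg_level k) z.
Proof. exact: scale1r. Qed.

Lemma lacunary_lipschitz k l z (M : K) : absz (k - l) = 1%N -> 0 <= M ->
  (forall i, `|z i| <= weight lacunary_weight l i * M) ->
  `|lsum k z - lsum l z| <= 2 * M.
Proof.
move=> kl M0 zM; rewrite !lsum_window.
have zM' i : (forall m, m = neg_level l -> lacunary_depth m i <= 1)%N ->
    l <= 0 -> `|z i| <= 2 * M.
  move=> di l0; apply: le_trans (zM i) _; rewrite ler_wpM2r //.
  rewrite -[leRHS]expr1 ler_weXn2l ?ler1n // /lacunary_weight.
  have := di _ erefl; case: l l0 {kl zM di} => [[|l]|l] //= _; lia.
have [E|[[lE [kE l0]]|[kE [lE l0]]]] : neg_level k = neg_level l \/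
    (neg_level k = (neg_level l).+1 /\ neg_level l = neg_level l /\ l <= 0) \/
    (neg_level l = (neg_level k).+1 /\ neg_level l = neg_level l /\ l <= 0).
  by case: k kl {zM zM'} => [k|k]; case: l => [l|l] kl /=; lia.
- by rewrite E subrr normr0 mulr_ge0.
- rewrite lE; have [->|[i [d1 d2 [->|->]]]] := window_sumS (neg_level l) z.
  + by rewrite subrr normr0 mulr_ge0.
  + by rewrite addrAC subrr add0r zM' // => _ ->.
  + by rewrite opprD addrA subrr add0r normrN zM' // => _ ->.
- rewrite kE; have [->|[i [d1 d2 [->|->]]]] := window_sumS (neg_level k) z.
  + by rewrite subrr normr0 mulr_ge0.
  + by rewrite opprD addrA subrr add0r normrN zM' // => _ ->; rewrite kE.
  + by rewrite addrAC subrr add0r zM' // => _ ->; rewrite kE.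
Qed.

End lacunary.

Section lacunary_dynamics.
Context {K : numFieldType} {Y : normedModType K}.
Hypothesis hK : inv_nat_null K.

Notation T h := (step lacunary_support_neq0 lacunary_weight_lipschitz
  (@lacunary_lipschitz K Y) h).
Notation site := (site (Y := Y) lacunary_weight (fun=> 1 : K) lacunary_support_neq0).
Notation lcoef := (coef (fun=> 1 : K) lacunary_support).

Lemma mem_log_window n i : i \in log_window n ->
  (`|i| <= (trunc_log 2 n).+1)%N /\ (trunc_log 2 n <= `|i|.+1)%N.
Proof.
by rewrite /log_window; case: ifP => _; rewrite !inE;
  [move=> /eqP -> | move=> /orP[] /eqP ->]; lia.
Qed.

Lemma lcoef_notin k i : i \notin log_window (neg_level k) -> lcoef k i = 0.
Proof. by move=> /count_memPn h; rewrite /coef /lacunary_support h mulr0. Qed.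

Lemma lacunary_depth_ge n i : i != 0 -> (n - 2 ^ `|i|.+2 <= lacunary_depth n i)%N.
Proof.
move=> /negPf i0; rewrite /lacunary_depth i0 /distn.
have : (2 ^ `|i|.-1 <= 2 ^ `|i|.+2)%N by rewrite leq_exp2l //; lia.
by move: (2 ^ _)%N (2 ^ _)%N => a b; lia.
Qed.

Lemma lacunary_depth_ge_index n i : i != 0 ->
  (`|i|.-1 - n <= lacunary_depth n i)%N.
Proof.
move=> /negPf i0; rewrite /lacunary_depth i0 /distn.
have : (2 ^ `|i|.-1 <= 2 ^ `|i|.+2)%N by rewrite leq_exp2l //; lia.
have := ltn_expl `|i|.-1 (isT : 1 < 2)%N.
by move: (2 ^ _)%N (2 ^ _)%N => a b; lia.
Qed.

(** At every far level some index of the window is far from both its entry and its exit, so a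
    correction placed there is damped. *)
Lemma deep_window_index m : (2 <= trunc_log 2 m)%N -> exists i,
  [/\ i != 0, count_mem i (log_window m) = 1%N, (trunc_log 2 m <= `|i|.+1)%N &
    (trunc_log 2 m - 2 <= lacunary_depth m i)%N].
Proof.
move=> j2; have m0 : (0 < m)%N by case: m j2 => //; rewrite trunc_log0.
have /andP[] := trunc_log_bounds (isT : 1 < 2)%N m0; rewrite /log_window.
case: (trunc_log 2 m) j2 => [|[|q]] // _; rewrite !expnS.
have := ltn_expl q (isT : 1 < 2)%N; set p := (2 ^ q)%N => qp h1 h2.
have [jo|je] := boolP (odd q.+2).
  exists q.+2%:Z; split=> //=; first by rewrite eqxx.
  by rewrite /lacunary_depth /distn /= !expnS -/p; lia.
(* Here [4p <= m < 8p]. Index [q + 3] enters at [4p] and [q + 1] leaves at [8p], so the midpoint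
   [6p] decides which of them is deep. *)
have [hm|hm] := leqP (6 * p) m.
  exists q.+3%:Z; split; [by []|..].
  - by rewrite /=; case: eqP => ?; case: eqP => ?; lia.
  - by rewrite /=; lia.
  - by rewrite /lacunary_depth /distn /= !expnS -/p; lia.
exists q.+1%:Z; split; [by []|..].
- by rewrite /=; case: eqP => ?; case: eqP => ?; lia.
- by rewrite /=; lia.
- by rewrite /lacunary_depth /distn /= !expnS -/p; lia.
Qed.

Section forward.
Hypothesis h : absz 1 = 1%N.

Lemma neg_level_sub k n : (`|k| <= n)%N ->
  (n - `|k| <= neg_level (k - 1 * n%:Z))%N /\
  forall i, lacunary_weight (k - 1 * n%:Z) i =
    lacunary_depth (neg_level (k - 1 * n%:Z)) i.
Proof.
move=> kn; have : k - 1 * n%:Z <= 0 by lia.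
have : absz (k - 1 * n%:Z)%R = neg_level (k - 1 * n%:Z) \/ 0 < k - 1 * n%:Z.
  by case: (k - 1 * n%:Z) => [[|m]|m] /=; [left|right|left].
move=> a b; split; first by lia.
by move=> i; rewrite /lacunary_weight; case: (k - _) b => [[|m]|m] //=; rewrite addn0.
Qed.

Lemma stable_lacunary_site k i y : i != 0 -> stable_set 0 (T h) (site k i y).
Proof.
move=> i0; apply/cvg0_normP => e e0.
have [N hN] := pow2_small hK (normr_ge0 y) e0.
exists (N + `|k| + 2 ^ `|i|.+2)%N => // n Nn.
have {}Nn : (N + `|k| + 2 ^ `|i|.+2 <= n)%N := Nn.
have [|m1 m2] := @neg_level_sub k n; first by lia.
rewrite iter_step_site; apply: site_lt.
  apply: hN; rewrite m2; have := lacunary_depth_ge (neg_level (k - 1 * n%:Z)) i0; lia.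
rewrite lcoef_notin ?scale0r ?normr0 ?mulr0 //.
apply/negP => /mem_log_window[_].
apply/negP; rewrite -ltnNge; apply: trunc_log_max => //.
by lia.
Qed.

(** The correction [- y] is placed at a deep index of the window reached after [n] steps. It cancels
    [y] there and is invisible at level [k]. As the index depends on [n], no single null vector
    results. *)
Lemma nearly_null_lacunary_site0 k y : nearly_null (T h) (site k 0 y).
Proof.
move=> e e0; have [N hN] := pow2_small hK (normr_ge0 (- y)) e0.
(* Large enough for the index found below to lie outside the window of level [k] and to have depth
   at least [N] at both levels. *)
pose L := (N + `|k| + neg_level k + trunc_log 2 (neg_level k) + 5)%N.
exists (2 ^ L + `|k|)%N => // n Nn; have {}Nn : (2 ^ L + `|k| <= n)%N := Nn.
have [|m1 m2] := @neg_level_sub k n; first by lia.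
have jL : (L <= trunc_log 2 (neg_level (k - 1 * n%:Z)))%N.
  by apply: trunc_log_max => //; lia.
have [|i [i0 ci ji di]] := @deep_window_index (neg_level (k - 1 * n%:Z)).
  by apply: leq_trans jL; rewrite /L; lia.
exists (site k i (- y) + site k 0 y).
  rewrite opprD addrCA subrr addr0 normrN; apply: site_lt.
    apply: hN; have := lacunary_depth_ge_index (neg_level k) i0.
    rewrite /lacunary_weight; move: jL ji; rewrite /L; lia.
  rewrite lcoef_notin ?scale0r ?normr0 ?mulr0 //.
  by apply/negP => /mem_log_window[+ _]; move: jL ji; rewrite /L; lia.
rewrite iter_linearD !iter_step_site; apply: site_pair_lt => //.
  by apply: hN; rewrite m2; move: jL di; rewrite /L; lia.
by rewrite /coef ci mulr1 scale1r subrr normr0 mulr0.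
Qed.

Lemma nearly_null_lacunary x : nearly_null (T h) x.
Proof.
apply: (site_ind (d := lacunary_weight) (c := fun=> 1)
  (s_neq0 := lacunary_support_neq0)) x.
- exact: nearly_nullD.
- exact: nearly_null_closed.
move=> k i y; have [->|i0] := eqVneq i 0; first exact: nearly_null_lacunary_site0.
exact/null_nearly_null/stable_lacunary_site.
Qed.

Lemma stable_lacunary_base0 x : stable_set 0 (T h) x ->
  base lacunary_weight (fun=> 1) lacunary_support x = 0.
Proof.
move=> /cvg0_normP hx; apply/eqP; rewrite -normr_le0.
apply/ler_addgt0Pr => e e0; rewrite add0r.
have e30 : 0 < e / 3 by rewrite divr_gt0.
have [N _ hN] := hx _ e30; set b := base _ _ _ _.
pose z := of_coord lacunary_weight (fun=> 1) lacunary_support 0 (x 0).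
have lt j : (N <= j)%N -> `|b + window_sum (2 ^ j) z| < e / 3.
  move=> Nj; have Nj' : (N <= 2 ^ j)%N by apply: ltnW (leq_ltn_trans Nj (ltn_expl _ _)).
  apply: le_lt_trans (hN _ Nj').
  have neg : neg_level (- (1 * (2 ^ j)%N%:Z)) = (2 ^ j)%N.
    by rewrite mul1r; case: (2 ^ j)%N.
  rewrite -{1}neg -lsum_window; apply: iter_step_base.
  by rewrite /lacunary_weight mul1r; case: (2 ^ j)%N.
(* An odd exponent past [N]: the windows at [2 ^ j], [2 ^ j.+1] and [2 ^ j.+2] are then [j], the
   pair [j], [j + 2], and [j + 2]. *)
pose j := N.*2.+1.
have w0 : window_sum (2 ^ j) z = z j%:Z.
  by rewrite /window_sum /log_window trunc_expnK //= odd_double big_seq1.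
have w1 : window_sum (2 ^ j.+1) z = z j%:Z + z j.+2%:Z.
  rewrite /window_sum /log_window trunc_expnK //= odd_double big_cons big_seq1.
  by congr (z _ + z _); lia.
have w2 : window_sum (2 ^ j.+2) z = z j.+2%:Z.
  by rewrite /window_sum /log_window trunc_expnK //= odd_double big_seq1.
have := lt j; have := lt j.+1; have := lt j.+2.
rewrite w0 w1 w2 => h2 h1 h0.
have -> : b = (b + z j%:Z) - (b + (z j%:Z + z j.+2%:Z)) + (b + z j.+2%:Z).
  have subDr (u v : Y) : u - (u + v) = - v by rewrite opprD addrA subrr sub0r.
  by rewrite [b + (z j%:Z + z j.+2%:Z)]addrA subDr addrCA addNr addr0.
have e3 : e = e / 3 + e / 3 + e / 3.
  by rewrite -mulr2n -mulrSr -[e / 3 *+ 3]mulr_natr divfK // pnatr_eq0.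
rewrite e3 (le_trans (ler_normD _ _)) // lerD //.
  rewrite (le_trans (ler_normB _ _)) // lerD // ltW //; [apply: h0|apply: h1]; rewrite /j; lia.
by apply: ltW; apply: h2; rewrite /j; lia.
Qed.

End forward.

Lemma stable_lacunary_inverse_dense (h : absz (-1) = 1%N) :
  dense (stable_set 0 (T h)).
Proof.
apply: (dense_sites (s_neq0 := lacunary_support_neq0) (c := fun=> 1)
  (d := lacunary_weight) (@stable_setD _ _ (T h))) => k i y e e0.
exists (site k i y); last by rewrite subrr normr0.
apply/cvg0_normP => {e0}e e0.
have [N hN] := pow2_small hK (normr_ge0 y) e0.
(* All levels [m >= 0] share the window of level 0, so this coefficient is constant while its weight
   grows. *)
have [M hM] := pow2_small hK (normr_ge0 (lcoef 0 i *: y)) e0.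
exists (N + M + `|k|)%N => // n Nn; have {}Nn : (N + M + `|k| <= n)%N := Nn.
have [m [mE mn]] : exists m : nat, k - -1 * n%:Z = m%:Z /\ (N + M <= m)%N.
  by exists (absz (k + n%:Z)%R); lia.
rewrite iter_step_site mE; apply: site_lt; first by apply: hN; rewrite /lacunary_weight /=; lia.
by apply: hM; rewrite /lacunary_weight /=; lia.
Qed.

Lemma lacunary_mixing_not_HC (y : Y) : y != 0 ->
  exists T : bounded_operator (c0 (c0 Y)),
    satisfies T Mixing /\ ~ satisfies T HC.
Proof.
move=> y0; have h : absz 1 = 1%N by []. have h' : absz (-1) = 1%N by [].
have TS x : T h (T h' x) = x by apply: step_inv.
exists (T h); split.
  exact: pair_mixing TS (nearly_null_lacunary h) (stable_lacunary_inverse_dense h').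
move=> /HC_stable_dense.
by apply: (base_null_not_dense lacunary_support_neq0 y0) => x; exact: stable_lacunary_base0.
Qed.

(** For the inverse, the scarce null vectors lie in the backward direction. The maps [S_n] may be
    unrelated for different [n] and avoid them, but the Kitai section must follow backward
    orbits. *)
Lemma lacunary_inverse_HC_not_Kitai (y : Y) : y != 0 ->
  exists T : bounded_operator (c0 (c0 Y)),
    satisfies T HC /\ ~ satisfies T Kitai.
Proof.
move=> y0; have h : absz 1 = 1%N by []. have h' : absz (-1) = 1%N by [].
have TS x : T h (T h' x) = x by apply: step_inv.
have ST x : T h' (T h x) = x by apply: step_inv.
have dS := stable_lacunary_inverse_dense h'.
exists (T h'); split.
  have [X0 h0] := mixing_HC_same_set hK (pair_inverse_mixing ST (nearly_null_lacunary h) dS)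
    dS (fun _ => id).
  by exists X0, X0.
move=> [X0 [Y0 hX]]; have [_ dY _] := hX.
have [_ YS] := Kitai_stable_subset TS hX.
apply: (base_null_not_dense lacunary_support_neq0 y0 _ dY) => x /YS.
exact: stable_lacunary_base0.
Qed.

End lacunary_dynamics.

(** * The chain of implications and its strictness *)

Section implications.
Context {K : numFieldType} {X : completeNormedModType K}.
Variable T : bounded_operator X.
Hypotheses (hK : inv_nat_null K) (sX : separable X).

Lemma arrow_satisfies i j : arrow i j -> satisfies T i -> satisfies T j.
Proof.
case.
- exact: chaotic_shift_Kitai_same_set.
- exact: Kitai_same_set_chaotic_shift.
- by move=> [X0 hX0]; exists X0, X0.
- by move=> /Kitai_HC; exact: HC_HC_same_set.
- by move=> [X0 hX0]; exists X0, X0.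
- exact: HC_HC_same_set.
- exact: HC_mixing.
- by move=> /shift_mixingP.
- by move=> /shift_mixingP.
Qed.

Lemma follows_satisfies i j : follows i j -> satisfies T i -> satisfies T j.
Proof. by elim=> // [a b /arrow_satisfies//|a b c _ IH1 _ IH2 /IH1/IH2]. Qed.

End implications.

(** The arrows put the seven assertions into four linearly ordered classes, so a pair not covered by
    [follows] goes strictly down. *)
Definition assertion_level (a : assertion) : nat :=
  match a with
  | Shift_chaotic | Kitai_same_set => 0
  | Kitai => 1
  | HC_same_set | HC => 2
  | Mixing | Shift_mixing => 3
  end.

Lemma level_follows i j :
  (assertion_level i <= assertion_level j)%N -> follows i j.
Proof.
have step a b : arrow a b -> follows a b by exact: rt_step.
have follows_trans a b c : follows a b -> follows b c -> follows a c by exact: rt_trans.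
have refl a : follows a a by exact: rt_refl.
(* The default value [Mixing] represents level 3. *)
pose rep n := nth Mixing [:: Kitai_same_set; Kitai; HC_same_set] n.
have to_rep a : follows a (rep (assertion_level a)).
  by case: a => //; apply: step; constructor.
have of_rep a : follows (rep (assertion_level a)) a.
  by case: a => //; apply: step; constructor.
have rep_le m n : (m <= n)%N -> follows (rep m) (rep n).
  elim: n => [|n IH]; first by rewrite leqn0 => /eqP ->.
  rewrite leq_eqVlt => /orP[/eqP -> //|/IH h]; apply: (follows_trans _ _ _ h).
  case: n {IH h} => [|[|[|n]]].
  - by apply: step; constructor.
  - by apply: step; constructor.
  - by apply: (follows_trans _ HC); apply: step; constructor.
  - by rewrite /rep !nth_default.
by move=> /rep_le h; exact: (follows_trans _ _ _ (to_rep i) (follows_trans _ _ _ h (of_rep j))).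
Qed.

(** One operator per boundary between consecutive classes is enough: it satisfies the class of [i],
    fails the class just below, and hence fails [j]. *)
Lemma level_counterexample (R : realType) (K : numFieldType) i j :
  real_or_complex R K -> (assertion_level j < assertion_level i)%N ->
  exists (X : completeNormedModType K) (T : bounded_operator X),
    separable X /\ satisfies T i /\ ~ satisfies T j.
Proof.
move=> /[dup] hRK /real_or_complex_inv_nat_null hK ji.
have [Y [sY [y y0]]] := separable_Banach_nonzero hRK.
have sX : separable (c0 (c0 Y)) := c0_separable (c0_separable sY).
have extend (T : bounded_operator (c0 (c0 Y))) p q :
    satisfies T p /\ ~ satisfies T q ->
    (assertion_level p <= assertion_level i)%N ->
    (assertion_level j <= assertion_level q)%N ->
    exists (X : completeNormedModType K) (T : bounded_operator X),
      separable X /\ satisfies T i /\ ~ satisfies T j.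
  move=> [Tp Tq] /level_follows pi /level_follows jq.
  exists (c0 (c0 Y)), T; split=> //; split.
    exact: (follows_satisfies hK sX pi).
  by move=> /(follows_satisfies hK sX jq).
have : (assertion_level i < 4)%N by case: (i).
case E: (assertion_level i) ji => [|[|[|[|//]]]] // ji _.
- have [T hT] := opposite_sums_Kitai hK y0.
  by apply: (extend T Kitai Kitai_same_set hT); rewrite ?E.
- have [T hT] := lacunary_inverse_HC_not_Kitai hK y0.
  by apply: (extend T HC Kitai hT); rewrite ?E.
- have [T hT] := lacunary_mixing_not_HC hK y0.
  by apply: (extend T Mixing HC hT); rewrite ?E.
Qed.

Theorem theorem4p3 (R : realType) (K : numFieldType)
    (hK : real_or_complex R K) :
  (forall (X : completeNormedModType K) (T : bounded_operator X),
      separable X ->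
      (satisfies T Shift_chaotic <-> satisfies T Kitai_same_set) /\
      (satisfies T Kitai_same_set -> satisfies T Kitai) /\
      (satisfies T Kitai -> satisfies T HC_same_set) /\
      (satisfies T HC_same_set <-> satisfies T HC) /\
      (satisfies T HC -> satisfies T Mixing) /\
      (satisfies T Mixing <-> satisfies T Shift_mixing)) /\
  (forall i j : assertion, ~ follows i j ->
      exists (X : completeNormedModType K) (T : bounded_operator X),
        separable X /\ satisfies T i /\ ~ satisfies T j).
Proof.
have hK' := real_or_complex_inv_nat_null hK.
split=> [X T sX|i j ij].
  have sat i j := @arrow_satisfies _ _ T hK' sX i j.
  split; [split|split; [|split; [|split; [split|split; [|split]]]]];
    by apply: sat; constructor.
apply: (level_counterexample hK); rewrite ltnNge; apply/negP.
by move=> /level_follows.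
Qed.
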